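(* Fix $\beta>0$. There exists an energy resolution $\sigma_E>0$, constant (independent of $n$), such that the following holds. For each $n$, let $H$ be the adjacency matrix of the cyclic graph on $n$ vertices, with vertex basis $|e_1\rangle,\dots,|e_n\rangle$ of $\mathbb{C}^n$, and let $\mathcal{L}_\beta$ be the CKG Lindbladian of $H$ at inverse temperature $\beta$ with energy resolution $\sigma_E$ and jump operators $A^a=\frac{1}{\sqrt n}|e_a\rangle\langle e_a|$, $a=1,\dots,n$. Then, as $n\to\infty$, the spectral gap of $\mathcal{L}_\beta$ is $\Theta(n^{-3})$.
   Context: CKG Lindbladian. Let $H$ be an $n\times n$ Hermitian matrix, $\beta>0$ an inverse temperature, $\sigma_E>0$ an energy resolution, and $\{A^a\}_{a\in[M]}$ a finite family of $n\times n$ matrices (jump operators), closed under adjoint as a multiset. A Bohr frequency is a difference of two eigenvalues of $H$. For a matrix $A$ and Bohr frequency $\nu$ let $A_\nu=\sum_{E-E'=\nu}P_E A P_{E'}$, where $P_E$ is the spectral projector of $H$ for eigenvalue $E$. Put $\hat f(\omega)=\frac{1}{\sqrt{\sigma_E\sqrt{2\pi}}}\exp\left(-\frac{\omega^2}{4\sigma_E^2}\right)$, $\hat A^a(\omega)=\sum_\nu \hat f(\omega-\nu)A^a_\nu$, $\gamma(\omega)=\exp\left(-\beta\max\left(\omega+\frac{\beta\sigma_E^2}{2},0\right)\right)$, $\theta(\nu_1,\nu_2)=\int_{-\infty}^\infty \gamma(\omega)\hat f(\omega-\nu_1)\hat f(\omega-\nu_2)\,d\omega$, and $$B=\sum_{a}\sum_{\nu_1,\nu_2}\frac{\tanh(-\beta(\nu_1-\nu_2)/4)}{2i}\,\theta(\nu_1,\nu_2)\,(A^a_{\nu_2})^\dagger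 A^a_{\nu_1}.$$ The CKG Lindbladian is $$\mathcal{L}_\beta[X]=-i[B,X]+\sum_{a}\int_{-\infty}^\infty\gamma(\omega)\left(\hat A^a(\omega)X\hat A^a(\omega)^\dagger-\tfrac12\{\hat A^a(\omega)^\dagger\hat A^a(\omega),X\}\right)d\omega .$$ It is self-adjoint for the KMS inner product $\langle X,Y\rangle=\mathrm{Tr}(X^\dagger\rho_\beta^{-1/2}Y\rho_\beta^{-1/2})$, where $\rho_\beta=e^{-\beta H}/\mathrm{Tr}(e^{-\beta H})$, and $\mathcal{L}_\beta[\rho_\beta]=0$. Its spectral gap is $\min_{j>1}|\lambda_j|$, where the eigenvalues are listed with multiplicity and $\lambda_1=0$ is the one with eigenvector $\rho_\beta$. *)

(* Defs.v *)
From HB Require Import structures.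
From mathcomp Require Import all_boot all_order all_algebra.
From mathcomp Require Import all_classical all_reals all_analysis.
From mathcomp Require Import complex.

Set Implicit Arguments.
Unset Strict Implicit.
Unset Printing Implicit Defensive.

Import Order.TTheory GRing.Theory Num.Theory.
Import numFieldNormedType.Exports.

Local Open Scope classical_set_scope.
Local Open Scope sesquilinear_scope.
Local Open Scope complex_scope.
Local Open Scope ring_scope.

Section scalar_functions.
Variable R : realType.
Implicit Types beta sigmaE : R.

Definition tanh (x : R) : R := (expR x - expR (- x)) / (expR x + expR (- x)).

Definition fhat sigmaE (omega : R) : R :=
  (Num.sqrt (sigmaE * Num.sqrt (2 * pi)))^-1
  * expR (- (omega ^+ 2 / (4 * sigmaE ^+ 2))).

Definition gamma beta sigmaE (omega : R) : R :=
  expR (- beta * Num.max (omega + beta * sigmaE ^+ 2 / 2) 0).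

Definition theta beta sigmaE (nu1 nu2 : R) : R :=
  \int[lebesgue_measure]_(omega in [set: R])
    (gamma beta sigmaE omega
     * fhat sigmaE (omega - nu1) * fhat sigmaE (omega - nu2)).

End scalar_functions.

Section spectral_data.
Variables (R : realType) (n : nat) (H : 'M[R[i]]_n).

(* All eigenvalues of a Hermitian matrix are real, so no eigenvalue is lost by
   ranging over E : R. *)
Definition energies : set R := [set E | eigenvalue H E%:C].

Definition bohr_frequencies : set R :=
  [set E - E' | E in energies & E' in energies].

(* The sums over these sets below use [\sum_(_ \in _)], which is only meaningful
   on finite supports. *)
Lemma finite_energies : finite_set energies.
Proof.
have p0 : char_poly H != 0 by rewrite monic_neq0 // char_poly_monic.
have [r Hr] := closed_field_poly_normal (char_poly H).
apply: sub_finite_set (finite_seq (map (@complex.Re R) r)) => E /= HE.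
apply/mapP; exists E%:C => //; move: HE.
rewrite /energies /= eigenvalue_root_char Hr.
by rewrite rootZ ?lead_coef_eq0// root_prod_XsubC.
Qed.

Lemma finite_bohr_frequencies : finite_set bohr_frequencies.
Proof. exact: finite_image2 finite_energies finite_energies. Qed.

(* [eigenspace] is spanned by the row vectors v with v *m H = E *: v. For a
   Hermitian H their adjoints span the column eigenspace, and the orthogonal
   projector onto the former, acting on rows, is as a matrix the orthogonal
   projector onto the latter, acting on columns. *)
Definition spectral_projector (E : R) : 'M[R[i]]_n :=
  proj_ortho (eigenspace H E%:C).

Definition bohr_component (A : 'M[R[i]]_n) (nu : R) : 'M[R[i]]_n :=
  \sum_(EE \in [set EE : R * R |
          [/\ energies EE.1, energies EE.2 & EE.1 - EE.2 = nu]])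
     spectral_projector EE.1 *m A *m spectral_projector EE.2.

(* exp (- beta H), by the functional calculus of the Hermitian matrix H *)
Definition boltzmann (beta : R) : 'M[R[i]]_n :=
  \sum_(E \in energies) (expR (- beta * E))%:C *: spectral_projector E.

Definition gibbs_state (beta : R) : 'M[R[i]]_n :=
  (\tr (boltzmann beta))^-1 *: boltzmann beta.

End spectral_data.

(* entrywise Lebesgue integral over the real line *)
Definition integral_mx (R : realType) (n : nat) (F : R -> 'M[R[i]]_n) :
    'M[R[i]]_n :=
  \matrix_(i, j)
    ((\int[lebesgue_measure]_(omega in [set: R]) complex.Re (F omega i j))
     +i* (\int[lebesgue_measure]_(omega in [set: R]) complex.Im (F omega i j))).

Section CKG.
Variables (R : realType) (n : nat) (H : 'M[R[i]]_n) (beta sigmaE : R).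
Variables (I : finType) (A : I -> 'M[R[i]]_n).

Definition filtered_jump (a : I) (omega : R) : 'M[R[i]]_n :=
  \sum_(nu \in bohr_frequencies H)
     (fhat sigmaE (omega - nu))%:C *: bohr_component H (A a) nu.

Definition coherent_term : 'M[R[i]]_n :=
  \sum_(a : I)
   \sum_(nu1 \in bohr_frequencies H)
    \sum_(nu2 \in bohr_frequencies H)
      ((tanh (- beta * (nu1 - nu2) / 4))%:C / (2 * 'i%C)
        * (theta beta sigmaE nu1 nu2)%:C)
      *: ((bohr_component H (A a) nu2)^t* *m bohr_component H (A a) nu1).

Definition dissipator (L X : 'M[R[i]]_n) : 'M[R[i]]_n :=
  L *m X *m L^t* - 2^-1 *: (L^t* *m L *m X + X *m (L^t* *m L)).

Definition CKG_lindbladian (X : 'M[R[i]]_n) : 'M[R[i]]_n :=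
  - 'i%C *: (coherent_term *m X - X *m coherent_term)
  + \sum_(a : I)
      integral_mx (fun omega => (gamma beta sigmaE omega)%:C
                                *: dissipator (filtered_jump a omega) X).

End CKG.

(* [is_spectral_gap L rho g]: the eigenvalues of the superoperator L, with
   algebraic multiplicity (which is the geometric one for a KMS-self-adjoint L),
   are 0, which has eigenvector rho, followed by those in [lambdas], and g is
   the least modulus of the latter. *)
Definition is_spectral_gap (R : realType) (n : nat)
    (L : 'M[R[i]]_n -> 'M[R[i]]_n) (rho : 'M[R[i]]_n) (g : R) : Prop :=
  exists lambdas : seq R[i],
    [/\ rho != 0, L rho = 0,
        char_poly (lin_mx L) = \prod_(l <- 0 :: lambdas) ('X - l%:P),
        exists2 l, l \in lambdas & `|l| = g%:C
      & forall l, l \in lambdas -> g%:C <= `|l| ].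

Section cycle.
Variables (R : realType) (n : nat).

(* [ordS] is the successor modulo n; this is the n-cycle for n >= 3 *)
Definition cycle_adjacency : 'M[R[i]]_n :=
  \matrix_(i, j) ((j == ordS i) || (i == ordS j))%:R.

Definition vertex_jump (a : 'I_n) : 'M[R[i]]_n :=
  ((Num.sqrt (n%:R : R))^-1)%:C *: delta_mx a a.

Lemma cycle_adjacency_selfadjoint : cycle_adjacency^t* = cycle_adjacency.
Proof. by apply/matrixP => i j; rewrite !mxE rmorph_nat orbC. Qed.

Lemma vertex_jump_selfadjoint (a : 'I_n) : (vertex_jump a)^t* = vertex_jump a.
Proof.
apply/matrixP => i j; rewrite !mxE andbC rmorphM rmorph_nat; congr (_ * _).
by apply/eqP; rewrite eq_complex /= ?oppr0 !eqxx.
Qed.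

Definition cycle_lindbladian (beta sigmaE : R) :
    'M[R[i]]_n -> 'M[R[i]]_n :=
  CKG_lindbladian cycle_adjacency beta sigmaE vertex_jump.

End cycle.

(* Main.v *)
(** Plane waves diagonalize the Hamiltonian of the cycle.  Averaging the vertex
    jumps over the cycle conserves momentum: in the plane-wave basis the
    coherent term B vanishes, and with a_k(t) = E_(k+t) - E_k the Lindbladian
    sends the entry (k + t, l + t) to (k, l) with rate
    n^-2 theta(- a_k(t), - a_l(t)), and damps (k, l) at the rate
    n^-2 sum_t (theta(a_k(t), a_k(t)) + theta(a_l(t), a_l(t))) / 2.

    Reflecting omega about - beta sigma^2 / 2 gives detailed balance for theta,
    so rescaling entry (k, l) by exp (beta (E_k + E_l) / 4) makes the generator
    Hermitian.  Its Dirichlet form is the sum of a jump part and of the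
    decoherence part with weights n^-2 sum_t defect(a_k(t), a_l(t)), where
    defect(a, b) = (theta(a, a) + theta(b, b)) / 2 - theta(a, b)
                 = 1/2 int gamma (f_a - f_b)^2
    is comparable to (a - b)^2 on bounded energies.

    Lower bound: off the diagonal, sum_t (a_k(t) - a_l(t))^2 >= 2 / n for
    k <> l, since nontrivial n-th roots of unity are at distance at least 1 / n
    from 1; so decoherence contributes at least a multiple of n^-3.  On the
    diagonal the jump part is a Markov chain with rates of order n^-2 between
    any two states, whose gap is of order 1 / n.
    Upper bound: the state supported on l = k + 1 on which the jump part
    vanishes has a_k(t) - a_l(t) = O(1 / n), hence Rayleigh quotient O(n^-3). *)

From HB Require Import structures.
Require Import Defs.
From mathcomp Require Import all_boot all_order all_algebra finmap.
From mathcomp Require Import all_classical all_reals all_analysis.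
From mathcomp Require Import measurable_realfun complex.
From mathcomp Require Import ring lra.
Import Order.TTheory GRing.Theory Num.Theory.
Import numFieldNormedType.Exports.
Local Open Scope classical_set_scope.
Local Open Scope sesquilinear_scope.
Local Open Scope complex_scope.
Local Open Scope ring_scope.

(** * The overlap integrals theta *)

Section lebesgue_reflection.
Context {R : realType}.
Local Notation mu := (@lebesgue_measure R).

Let refl (c : R) : measurableTypeR R -> measurableTypeR R := fun x => c - x.

Let measurable_refl c : measurable_fun setT (refl c).
Proof. exact: measurable_funB. Qed.

HB.instance Definition _ c :=
  isMeasurableFun.Build _ _ _ _ (refl c) (measurable_refl c).

Let preimage_refl c (a b : R) :
  refl c @^-1` `]a, b] = `[c - b, c - a[%classic.
Proof.
apply/seteqP; split => x /=; rewrite !in_itv/= /refl => /andP[h1 h2];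
  apply/andP; split; lra.
Qed.

(** The pushforward gives each half-open interval its length, and Lebesgue measure is unique with
    that property; the reflection only swaps which endpoint is included. *)
Lemma lebesgue_measure_reflection c (A : set R) : measurable A ->
  pushforward mu (refl c) A = mu A.
Proof.
move=> mA; apply/esym/lebesgue_measure_unique => //= _ [[a b]] _ <-.
rewrite /pushforward preimage_refl !lebesgue_measure_itv/=.
rewrite !lte_fin; have -> : (c - b < c - a) = (a < b) by lra.
by case: ifP => // _; rewrite -!EFinB; congr (_%:E); lra.
Qed.

Lemma Rintegral_reflection c (h : R -> R) : measurable_fun setT h ->
  (forall x, 0 <= h x) ->
  \int[mu]_(x in setT) h (c - x) = \int[mu]_(x in setT) h x.
Proof.
move=> mh h0; rewrite /Rintegral; congr fine.
transitivity (\int[pushforward mu (refl c)]_(x in setT) (h x)%:E)%E.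
  rewrite ge0_integral_pushforward//=; first exact/measurable_EFinP.
  by move=> x _; rewrite lee_fin.
by apply: eq_measure_integral => A mA _; exact: lebesgue_measure_reflection.
Qed.

End lebesgue_reflection.

Section theta.
Context {R : realType} (beta sigma : R).
Hypothesis sigma_gt0 : 0 < sigma.
Local Notation mu := (@lebesgue_measure R).
Local Notation f := (fhat sigma).
Local Notation g := (gamma beta sigma).
Local Notation th := (theta beta sigma).

Lemma gamma_ge0 w : 0 <= g w.
Proof. exact: expR_ge0. Qed.

Lemma fhat_ge0 w : 0 <= f w.
Proof. by rewrite mulr_ge0 ?invr_ge0 ?sqrtr_ge0 ?expR_ge0. Qed.

(** Completing the square: (w - a)^2 + (w - b)^2 = 2 (w - (a + b) / 2)^2 + (a - b)^2 / 2. Since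
    [fhat] is the square root of a normal density of deviation [sigma], the product is again such a
    density, centred at the midpoint, times an overlap factor. *)
Lemma fhat_mul a b w : f (w - a) * f (w - b) =
  expR (- ((a - b) ^+ 2 / (8 * sigma ^+ 2))) * normal_pdf ((a + b) / 2) sigma w.
Proof.
have s0 : sigma != 0 by rewrite gt_eqF.
have pi0 := pi_gt0 R.
rewrite normal_pdfE// /fhat /normal_peak /normal_fun.
have -> : Num.sqrt (sigma ^+ 2 * pi *+ 2) = Num.sqrt (sigma * Num.sqrt (2 * pi)) ^+ 2.
  rewrite sqr_sqrtr ?mulr_ge0 ?sqrtr_ge0 ?ltW//.
  rewrite -mulrnAr sqrtrM ?sqr_ge0// sqrtr_sqr gtr0_norm//.
  by rewrite -[pi *+ 2]mulr_natl.
rewrite mulrACA [RHS]mulrCA -exprVn -expr2; congr (_ * _).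
by rewrite -!expRD; congr expR; field.
Qed.

Lemma measurable_gamma : measurable_fun setT g.
Proof.
apply: measurableT_comp => //; apply: measurable_funM => //.
apply: measurable_maxr => //; exact: measurable_funD.
Qed.

Lemma measurable_fhat a : measurable_fun setT (fun w : R => f (w - a)).
Proof.
apply: measurable_funM => //; apply: measurableT_comp => //.
apply: measurableT_comp => //; apply: measurable_funM => //.
by apply: measurable_funX; exact: measurable_funB.
Qed.

Lemma measurable_theta_integrand a b :
  measurable_fun setT (fun w : R => g w * f (w - a) * f (w - b)).
Proof.
apply: measurable_funM; last exact: measurable_fhat.
by apply: measurable_funM; [exact: measurable_gamma|exact: measurable_fhat].
Qed.

Lemma integrable_fhat_mul a b :
  mu.-integrable setT (EFin \o (fun w => f (w - a) * f (w - b))).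
Proof.
rewrite (_ : (fun w => _) = (fun w => expR (- ((a - b) ^+ 2 / (8 * sigma ^+ 2)))
    * normal_pdf ((a + b) / 2) sigma w)); last first.
  by apply/funext => w; rewrite fhat_mul.
have := @integrable_normal_pdf R ((a + b) / 2) sigma.
exact: integrableZl.
Qed.

Lemma Rintegral_fhat_mul a b : \int[mu]_(w in setT) (f (w - a) * f (w - b)) =
  expR (- ((a - b) ^+ 2 / (8 * sigma ^+ 2))).
Proof.
under eq_Rintegral do rewrite fhat_mul.
rewrite RintegralZl//; last exact: integrable_normal_pdf.
by rewrite /Rintegral integral_normal_pdf mulr1.
Qed.

Hypothesis beta_gt0 : 0 < beta.

Lemma gamma_le1 w : g w <= 1.
Proof.
rewrite -expR0 ler_expR mulNr oppr_le0; apply: mulr_ge0; first exact: ltW.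
by rewrite le_max lexx orbT.
Qed.

Lemma integrable_theta_integrand a b :
  mu.-integrable setT (EFin \o (fun w => g w * f (w - a) * f (w - b))).
Proof.
apply: le_integrable (integrable_fhat_mul a b) => //.
  by apply/measurable_EFinP; exact: measurable_theta_integrand.
move=> w _ /=; rewrite lee_fin -mulrA normrM ger0_norm ?gamma_ge0//.
by rewrite ler_piMl// gamma_le1.
Qed.

Lemma theta_integrand_ge0 a b w : 0 <= g w * f (w - a) * f (w - b).
Proof.
apply: mulr_ge0; last exact: fhat_ge0.
by apply: mulr_ge0; [exact: gamma_ge0|exact: fhat_ge0].
Qed.

Lemma theta_ge0 a b : 0 <= th a b.
Proof. by apply: Rintegral_ge0 => w _; exact: theta_integrand_ge0. Qed.

(* The reflection w |-> - beta sigma^2 - w maps gamma to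
   exp (beta (w + beta sigma^2 / 2)) gamma. *)
Lemma theta_integrand_reflection a b w (w' := - (beta * sigma ^+ 2) - w) :
  g w' * f (w' - a) * f (w' - b) =
  expR (- (beta * (a + b) / 2)) * (g w * f (w - - a) * f (w - - b)).
Proof.
have s0 : sigma != 0 by rewrite gt_eqF.
rewrite -(mulrA (g w')) -(mulrA (g w)) !fhat_mul !normal_pdfE// /normal_fun /gamma.
rewrite !(mulrCA _ (normal_peak _)).
congr (_ * _); rewrite -!expRD; congr expR.
rewrite /w'; set x := w + beta * sigma ^+ 2 / 2.
have -> : - (beta * sigma ^+ 2) - w + beta * sigma ^+ 2 / 2 = - x.
  by rewrite /x; field.
have -> : Num.max (- x) 0 = Num.max x 0 - x.
  by rewrite /Num.max; do 2!case: ifP; lra.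
by rewrite {2}/x; set M := Num.max _ _; field.
Qed.

(** Change of variable by the reflection about - beta sigma^2 / 2. This is the only property of
    [theta] that makes the generator KMS-symmetric. *)
Lemma theta_detailed_balance a b :
  th a b = expR (- (beta * (a + b) / 2)) * th (- a) (- b).
Proof.
rewrite /theta -(@Rintegral_reflection _ (- (beta * sigma ^+ 2)))//; first last.
- exact: theta_integrand_ge0.
- exact: measurable_theta_integrand.
rewrite -RintegralZl//; last exact: integrable_theta_integrand.
apply: eq_Rintegral => w _; exact: theta_integrand_reflection.
Qed.

Let integrand_defectE a b w : g w * (f (w - a) - f (w - b)) ^+ 2 =
  g w * f (w - a) * f (w - a) + g w * f (w - b) * f (w - b) -
  2 * (g w * f (w - a) * f (w - b)).
Proof. ring. Qed.

Let integrable_defect1 a b : mu.-integrable setT (EFin \o (fun w =>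
  g w * f (w - a) * f (w - a) + g w * f (w - b) * f (w - b))).
Proof.
have ha := integrable_theta_integrand a a.
have hb := integrable_theta_integrand b b.
exact: (integrableD measurableT ha hb).
Qed.

Let integrable_defect2 a b : mu.-integrable setT (EFin \o (fun w =>
  2 * (g w * f (w - a) * f (w - b)))).
Proof.
have := integrable_theta_integrand a b.
exact: integrableZl.
Qed.

Lemma integrable_defect a b :
  mu.-integrable setT (EFin \o (fun w => g w * (f (w - a) - f (w - b)) ^+ 2)).
Proof.
rewrite (_ : (fun w => _) = (fun w => g w * f (w - a) * f (w - a)
    + g w * f (w - b) * f (w - b) - 2 * (g w * f (w - a) * f (w - b)))); last first.
  by apply/funext => w; exact: integrand_defectE.
have ha := integrable_defect1 a b; have hb := integrable_defect2 a b.
exact: (integrableB measurableT ha hb).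
Qed.

(** Expanding the square shows the defect to be half the [gamma]-weighted squared distance between
    two shifted filters; both bounds on it start from this form. *)
Lemma theta_defectE a b : (th a a + th b b) / 2 - th a b =
  2^-1 * \int[mu]_(w in setT) (g w * (f (w - a) - f (w - b)) ^+ 2).
Proof.
have -> : \int[mu]_(w in setT) (g w * (f (w - a) - f (w - b)) ^+ 2) =
    th a a + th b b - 2 * th a b.
  have ia := integrable_theta_integrand a a.
  have ib := integrable_theta_integrand b b.
  have iab := integrable_theta_integrand a b.
  rewrite -(RintegralZl 2 measurableT iab) -(RintegralD measurableT ia ib).
  rewrite -(RintegralB measurableT (integrable_defect1 a b) (integrable_defect2 a b)).
  by apply: eq_Rintegral => w _; exact: integrand_defectE.
move: (th a a) (th b b) (th a b) => x y z; lra.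
Qed.

(** With [gamma] bounded by 1, the integral becomes 2 (1 - exp (- x)) for x = (a - b)^2 / (8
    sigma^2), and 1 - exp (- x) <= x. *)
Lemma theta_defect_le a b :
  (th a a + th b b) / 2 - th a b <= (a - b) ^+ 2 / (8 * sigma ^+ 2).
Proof.
have ia := integrable_fhat_mul a a; have ib := integrable_fhat_mul b b.
have iab := integrable_fhat_mul a b.
have i1 : mu.-integrable setT
    (EFin \o (fun w => f (w - a) * f (w - a) + f (w - b) * f (w - b))).
  exact: (integrableD measurableT ia ib).
have i2 : mu.-integrable setT (EFin \o (fun w => 2 * (f (w - a) * f (w - b)))).
  by move: iab; exact: integrableZl.
have i3 : mu.-integrable setT (EFin \o (fun w =>
    f (w - a) * f (w - a) + f (w - b) * f (w - b) - 2 * (f (w - a) * f (w - b)))).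
  exact: (integrableB measurableT i1 i2).
rewrite theta_defectE; set J := Rintegral _ _ _.
have /le_trans : J <= \int[mu]_(w in setT)
    (f (w - a) * f (w - a) + f (w - b) * f (w - b) - 2 * (f (w - a) * f (w - b))).
  apply: le_Rintegral => //; first exact: integrable_defect.
  move=> w _; have -> : f (w - a) * f (w - a) + f (w - b) * f (w - b) -
      2 * (f (w - a) * f (w - b)) = (f (w - a) - f (w - b)) ^+ 2 by ring.
  by rewrite ler_piMl ?sqr_ge0// gamma_le1.
rewrite RintegralB// RintegralD// RintegralZl// !Rintegral_fhat_mul.
rewrite !subrr expr0n /= mul0r oppr0 expR0.
set x := _ / _ => /(_ (2 * x)) h.
suff : J <= 2 * x by move=> ?; lra.
by apply: h; have := expR_ge1Dx (- x); lra.
Qed.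

(** A nonnegative integrand may be restricted to an interval of measure 1, so a pointwise lower
    bound there bounds the integral. *)
Lemma Rintegral_ge_unit_itv (h : R -> R) (l c : R) :
  mu.-integrable setT (EFin \o h) -> (forall x, 0 <= h x) ->
  (forall x, l <= x <= l + 1 -> c <= h x) ->
  c <= \int[mu]_(x in setT) h x.
Proof.
move=> ih h0 hc.
have mI : measurable (`[l, l + 1]%classic : set R) by [].
have -> : c = \int[mu]_(x in `[l, l + 1]) c.
  rewrite Rintegral_cst//= lebesgue_measure_itv/= lte_fin ltrDl ltr01.
  by rewrite -EFinB /= addrAC subrr add0r mulr1.
apply: (@le_trans _ _ (\int[mu]_(x in `[l, l + 1]) h x)).
  apply: le_Rintegral => //; last first.
  - exact: integrableS ih.
  - apply/integrableP; split; first exact: measurable_cst.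
    rewrite integral_cst//= lebesgue_measure_itv/= lte_fin ltrDl ltr01.
    by rewrite -EFinB -EFinM ltry.
rewrite Rintegral_mkcond; apply: le_Rintegral => //.
- by rewrite -restrict_EFin; rewrite -integrable_mkcond//; exact: integrableS ih.
- by move=> x _; rewrite patchE; case: ifP.
Qed.

Let K := (Num.sqrt (sigma * Num.sqrt (2 * pi)))^-1.

Let K_gt0 : 0 < K.
Proof.
rewrite invr_gt0 sqrtr_gt0 mulr_gt0// sqrtr_gt0 mulr_gt0// pi_gt0//.
Qed.

(** The lower bounds below integrate over the window [5, 6], just to the right of [-4, 4], where all
    energy differences of the cycle lie. [gamma] is nonincreasing, so its value at 6 is a lower
    bound there. *)
Let gamma_lb w : w <= 6 -> expR (- (beta * (6 + beta * sigma ^+ 2 / 2))) <= g w.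
Proof.
move=> w6; rewrite ler_expR mulNr lerN2 ler_pM2l//.
have h : 0 <= beta * sigma ^+ 2 / 2 by rewrite !mulr_ge0 ?sqr_ge0 ?ltW.
by rewrite ge_max; apply/andP; split; lra.
Qed.

(** A point of [5, 6] is at distance at most 10 from a centre in [-4, 4], and 10^2 / 4 = 25. *)
Let sqr_lb (x : R) : `|x| <= 10 -> expR (- (25 / sigma ^+ 2)) <= expR (- (x ^+ 2 / (4 * sigma ^+ 2))).
Proof.
move=> x10; rewrite ler_expR lerN2.
have -> : 25 / sigma ^+ 2 = 100 / (4 * sigma ^+ 2).
  by have := sigma_gt0; move=> ?; field; rewrite gt_eqF.
rewrite ler_pM2r ?invr_gt0 ?mulr_gt0 ?exprn_gt0//.
by rewrite -real_normK ?num_real//; have := normr_ge0 x; nra.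
Qed.

Lemma theta_diag_lb : exists2 c, 0 < c & forall a, `|a| <= 4 -> c <= th a a.
Proof.
exists (expR (- (beta * (6 + beta * sigma ^+ 2 / 2))) *
        (K * expR (- (25 / sigma ^+ 2))) * (K * expR (- (25 / sigma ^+ 2)))).
  by rewrite !mulr_gt0 ?expR_gt0.
move=> a; rewrite ler_norml => /andP[a1 a2]; apply: (@Rintegral_ge_unit_itv _ 5).
- exact: integrable_theta_integrand.
- exact: theta_integrand_ge0.
move=> w /andP[w1 w2].
have wa : K * expR (- (25 / sigma ^+ 2)) <= f (w - a).
  by rewrite ler_pM2l//; apply: sqr_lb; rewrite ler_norml; lra.
have k0 : 0 <= K * expR (- (25 / sigma ^+ 2)) by rewrite mulr_ge0 ?expR_ge0 ?ltW.
have gw : expR (- (beta * (6 + beta * sigma ^+ 2 / 2))) <= g w.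
  by apply: gamma_lb; lra.
apply: ler_pM => //; first by apply: mulr_ge0 => //; exact: expR_ge0.
by apply: ler_pM => //; exact: expR_ge0.
Qed.

(** On the window [5, 6] both filters are seen on their decreasing flank, at distance at least 1
    from the centres, so they differ by at least a multiple of the distance of the centres. *)
Lemma theta_defect_ge : exists2 c, 0 < c & forall a b, `|a| <= 4 -> `|b| <= 4 ->
  c * (a - b) ^+ 2 <= (th a a + th b b) / 2 - th a b.
Proof.
set k := K * expR (- (25 / sigma ^+ 2)) / (2 * sigma ^+ 2).
have k0 : 0 < k.
  apply: divr_gt0; first by apply: mulr_gt0 => //; exact: expR_gt0.
  by rewrite mulr_gt0// exprn_gt0.
exists (2^-1 * (expR (- (beta * (6 + beta * sigma ^+ 2 / 2))) * k ^+ 2)).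
  apply: mulr_gt0; rewrite ?invr_gt0//; apply: mulr_gt0; first exact: expR_gt0.
  by rewrite exprn_gt0.
move=> a b; rewrite !ler_norml => /andP[a1 a2] /andP[b1 b2].
rewrite theta_defectE -(mulrA 2^-1) ler_pM2l ?invr_gt0//.
apply: (@Rintegral_ge_unit_itv _ 5).
- exact: integrable_defect.
- by move=> w; rewrite mulr_ge0 ?sqr_ge0 ?gamma_ge0.
move=> w /andP[w1 w2]; rewrite -(mulrA (expR _)); apply: ler_pM.
- exact: expR_ge0.
- by rewrite mulr_ge0 ?sqr_ge0.
- by apply: gamma_lb; lra.
(* With exponents - u and - v, exp (- u) - exp (- v) >= exp (- v) (v - u). Here v - u = (y - x) (2 w
   - x - y) / (4 sigma^2), and 2 w - x - y >= 10 - 8 = 2 on the window. *)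
have fdiff x y : -4 <= x -> x <= y -> y <= 4 -> k * (y - x) <= f (w - y) - f (w - x).
  move=> x4 xy y4.
  have -> : k * (y - x) =
      K * (expR (- (25 / sigma ^+ 2)) * ((y - x) / (2 * sigma ^+ 2))).
    by rewrite /k; ring.
  rewrite /fhat -/K -mulrBr ler_pM2l//.
  set u := (w - y) ^+ 2 / _; set v := (w - x) ^+ 2 / _.
  have s2 : 0 < sigma ^+ 2 by rewrite exprn_gt0.
  have uv : (y - x) / (2 * sigma ^+ 2) <= v - u.
    rewrite /u /v -mulrBl.
    have -> : (y - x) / (2 * sigma ^+ 2) = (2 * (y - x)) / (4 * sigma ^+ 2).
      by field; rewrite gt_eqF.
    rewrite ler_pM2r ?invr_gt0 ?mulr_gt0//; nra.
  have ev : expR (- (25 / sigma ^+ 2)) <= expR (- v).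
    by apply: sqr_lb; rewrite ler_norml; lra.
  have -> : expR (- u) = expR (- v) * expR (v - u) by rewrite -expRD; congr expR; ring.
  have e1 := expR_ge1Dx (v - u); have ev0 := expR_gt0 (- v).
  have d0 : 0 <= (y - x) / (2 * sigma ^+ 2).
    by apply: divr_ge0; [rewrite subr_ge0|rewrite mulr_ge0 ?ltW].
  apply: (@le_trans _ _ (expR (- v) * ((y - x) / (2 * sigma ^+ 2)))).
    by rewrite ler_wpM2r.
  apply: (@le_trans _ _ (expR (- v) * (v - u))); first by rewrite ler_pM2l.
  by rewrite -subr_ge0 -[expR (- v) * _ - _]mulr1; nra.
rewrite -exprMn -[leRHS]real_normK ?num_real// -[leLHS]real_normK ?num_real//.
rewrite lerXn2r ?nnegrE ?normr_ge0// normrM (gtr0_norm k0).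
have [ab|ba] := leP a b.
  rewrite (distrC a b) (ger0_norm (_ : 0 <= b - a)) ?subr_ge0//; apply: (le_trans (fdiff _ _ a1 ab b2)).
  by rewrite distrC ler_norm.
have ab0 : 0 <= a - b by rewrite subr_ge0 ltW.
rewrite (ger0_norm ab0); apply: (le_trans (fdiff _ _ b1 (ltW ba) a2)).
by rewrite ler_norm.
Qed.
End theta.

(** * Spectral gaps from a Hermitian quadratic form *)

(** det P det (X - A) = det (X - B) det P over the polynomial ring, and the nonzero constant det P
    cancels. *)
Lemma char_poly_intertwined (F : fieldType) m (P A B : 'M[F]_m) :
  P \in unitmx -> P *m A = B *m P -> char_poly A = char_poly B.
Proof.
move=> uP PA; pose Q := map_mx polyC P.
have dQ : \det Q != 0 by rewrite det_map_mx polyC_eq0 -unitfE -unitmxE.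
apply: (mulfI dQ); rewrite /char_poly -det_mulmx [RHS]mulrC -det_mulmx.
congr (\det _); rewrite /char_poly_mx mulmxBr mulmxBl scalar_mxC.
by rewrite -!map_mxM PA.
Qed.

Lemma char_poly_diag_mx (F : comNzRingType) m (d : 'rV[F]_m) :
  char_poly (diag_mx d) = \prod_i ('X - (d 0 i)%:P).
Proof.
rewrite char_poly_trig ?diag_mx_is_trig//.
by apply: eq_bigr => i _; rewrite mxE eqxx mulr1n.
Qed.

Section hermitian_gap.
Context {R : realType}.
Local Notation C := R[i].

(** Diagonalize N in an orthonormal basis. The lower form bound on the complement of the kernel
    vector [v0] forces the eigenvalue 0 to be simple and all others to be at most - lo; the Rayleigh
    quotient of [v1] puts one of the others above - up. *)
Lemma hermitian_spectral_gap m (N : 'M[C]_m) (v0 v1 : 'rV[C]_m) (lo up : R) :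
  N^t* = N -> 0 < lo ->
  v0 != 0 -> v0 *m N = 0 ->
  (forall u : 'rV_m, (u *m v0^t*) 0 0 = 0 ->
     lo%:C * (u *m u^t*) 0 0 <= - (u *m N *m u^t*) 0 0) ->
  v1 != 0 -> (v1 *m v0^t*) 0 0 = 0 ->
  - (v1 *m N *m v1^t*) 0 0 <= up%:C * (v1 *m v1^t*) 0 0 ->
  exists (g : R) (s : seq C),
    [/\ lo <= g <= up, char_poly N = \prod_(l <- 0 :: s) ('X - l%:P),
        exists2 l, l \in s & `|l| = g%:C
      & forall l, l \in s -> g%:C <= `|l| ].
Proof.
move=> hN lo0 v00 v0N lower v10 v1v0 upper.
have Nh : N \is hermsymmx.
  by apply/is_hermitianmxP; rewrite expr0 scale1r hN.
have /orthomx_spectralP := hermitian_normalmx Nh.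
have Dre := hermitian_spectral_diag_real Nh.
set P := spectralmx N; set D := spectral_diag N => NE.
have uP : P \in unitmx := spectral_unit N.
have Pu : P \is unitarymx := spectral_unitarymx N.
have PPt : P *m P^t* = 1%:M by apply/unitarymxP.
have PtP : P^t* *m P = 1%:M by rewrite -invmx_unitary// mulVmx.
rewrite invmx_unitary// in NE.
have dotE (u v : 'rV[C]_m) : ((u *m P) *m (v *m P)^t*) 0 0 = \sum_i u 0 i * (v 0 i)^*.
  rewrite trmx_mul map_mxM mulmxA -[_ *m P *m _]mulmxA PPt mulmx1 mxE.
  by apply: eq_bigr => i _; rewrite !mxE.
have formE (u : 'rV[C]_m) :
    - ((u *m P) *m N *m (u *m P)^t*) 0 0 = \sum_i (- D 0 i) * `|u 0 i| ^+ 2.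
  rewrite NE trmx_mul map_mxM !mulmxA.
  rewrite -[u *m P *m _]mulmxA PPt mulmx1 -[_ *m P *m _]mulmxA PPt mulmx1.
  rewrite mxE -sumrN; apply: eq_bigr => i _.
  rewrite mul_mx_diag !mxE normCK; ring.
have expand (v : 'rV[C]_m) : v = (v *m P^t*) *m P by rewrite -mulmxA PtP mulmx1.
have dot0 (u : 'rV[C]_m) :
    ((u *m P) *m v0^t*) 0 0 = \sum_i u 0 i * ((v0 *m P^t*) 0 i)^*.
  by rewrite {1}(expand v0) dotE.
set c0 := v0 *m P^t* in dot0 *; set c1 := v1 *m P^t*.
(* A coordinate of the kernel vector can be nonzero only where the eigenvalue is 0; [i0] will be
   such a coordinate. *)
have c0D i : c0 0 i * D 0 i = 0.
  have : (c0 *m diag_mx D) 0 i = 0.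
    have -> : c0 *m diag_mx D = v0 *m N *m P^t*.
      by rewrite NE !mulmxA -[_ *m P *m _]mulmxA PPt mulmx1.
    by rewrite v0N mul0mx mxE.
  by rewrite mul_mx_diag mxE.
have [i0 c0i0] : exists i0, c0 0 i0 != 0.
  apply/existsP; apply: contraNT v00; rewrite negb_exists => /forallP h.
  rewrite (expand v0) -/c0; suff -> : c0 = 0 by rewrite mul0mx.
  by apply/rowP => i; rewrite [RHS]mxE; apply/eqP; move: (h i); rewrite negbK.
have Di0 : D 0 i0 = 0.
  by move/eqP: (c0D i0); rewrite mulf_eq0 (negbTE c0i0) => /eqP.
have Dlo j : j != i0 -> lo%:C <= - D 0 j.
  move=> ji0.
  (* A test vector supported on [j] and [i0] and orthogonal to [v0]. As [D 0 i0] is 0, its form sees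
     only coordinate [j], while its norm is at least that of this coordinate. *)
  pose c := \row_i (if i == j then (c0 0 i0)^* else if i == i0 then - (c0 0 j)^* else 0) : 'rV[C]_m.
  have two (F : 'I_m -> C) : (forall i, i != j -> i != i0 -> F i = 0) ->
      \sum_i F i = F j + F i0.
    move=> F0; rewrite (bigD1 j)//= (bigD1 i0) 1?eq_sym//= big1 ?addr0//.
    by move=> i /andP[? ?]; exact: F0.
  have ct i : i != j -> i != i0 -> c 0 i = 0.
    by move=> /negbTE h1 /negbTE h2; rewrite mxE h1 h2.
  have cj : c 0 j = (c0 0 i0)^* by rewrite mxE eqxx.
  have ci0 : c 0 i0 = - (c0 0 j)^* by rewrite mxE eq_sym (negbTE ji0) eqxx.
  have := lower (c *m P); rewrite dot0 two; last first.
    by move=> i h1 h2; rewrite ct// mul0r.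
  rewrite cj ci0 mulNr [X in X - _]mulrC subrr => /(_ erefl).
  rewrite formE dotE !two; last 2 first.
  - by move=> i h1 h2; rewrite ct// normr0 expr0n mulr0.
  - by move=> i h1 h2; rewrite ct// mul0r.
  rewrite Di0 oppr0 mul0r addr0 -!normCK => h.
  have cjp : 0 < `|c 0 j| ^+ 2.
    by rewrite exprn_gt0// normr_gt0 cj conjC_eq0.
  rewrite -(ler_pM2r cjp); apply: le_trans h.
  by apply: ler_wpM2l; [rewrite ler0c ltW|rewrite lerDl exprn_ge0].
(* By [Dlo] the kernel vector lives on [i0] alone, so orthogonality to it kills this coordinate of
   [v1]. *)
have c1i0 : c1 0 i0 = 0.
  move: v1v0; rewrite (expand v1) -/c1 dot0 (bigD1 i0)//= big1 => [|i ii0].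
    by rewrite addr0 => /eqP; rewrite mulf_eq0 conjC_eq0 (negbTE c0i0) orbF => /eqP.
  have : c0 0 i = 0.
    move/eqP: (c0D i); rewrite mulf_eq0 => /orP[/eqP //|/eqP Di].
    by have := Dlo _ ii0; rewrite Di oppr0 lecR leNgt lo0.
  by move=> ->; rewrite rmorph0 mulr0.
have Dr j : exists2 x : R, D 0 j = (- x)%:C & 0 <= x \/ j = i0.
  have /mxOverP/(_ 0 j)/complex_realP[k Dk] := Dre.
  exists (- k); rewrite ?opprK//.
  have [->|/Dlo] := eqVneq j i0; [by right|move=> h; left].
  by move: h; rewrite [D 0 j]Dk -rmorphN lecR => ?; lra.
pose G j := - complex.Re (D 0 j).
have DG j : D 0 j = (- G j)%:C.
  by have [x Dx _] := Dr j; rewrite /G Dx /= opprK.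
have Glo j : j != i0 -> lo <= G j.
  by move=> /Dlo; rewrite DG -rmorphN opprK lecR.
(* If every [G j] with [j != i0] exceeded [up], the form of [v1] would strictly exceed its upper
   bound. *)
have [j1 j1i0 Gj1] : exists2 j1, j1 != i0 & G j1 <= up.
  have [/existsP[j /andP[? ?]]|h] := boolP [exists j, (j != i0) && (G j <= up)].
    by exists j.
  exfalso; move: upper; rewrite (expand v1) -/c1 formE dotE mulr_sumr.
  rewrite -subr_ge0 -sumrB => h2.
  have [k c1k] : exists k, c1 0 k != 0.
    apply/existsP; apply: contraNT v10; rewrite negb_exists => /forallP h'.
    rewrite (expand v1) -/c1; suff -> : c1 = 0 by rewrite mul0mx.
    by apply/rowP => i; rewrite [RHS]mxE; apply/eqP; move: (h' i); rewrite negbK.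
  have Gup j : j != i0 -> up < G j.
    move=> ji0; rewrite ltNge; move: h; rewrite negb_exists => /forallP/(_ j).
    by rewrite ji0.
  move: h2; apply/negP; rewrite lt_geF// (bigD1 k)//=.
  have term j : up%:C * (c1 0 j * (c1 0 j)^*) - - D 0 j * `|c1 0 j| ^+ 2
      = - ((G j - up)%:C * `|c1 0 j| ^+ 2).
    by rewrite -normCK DG rmorphB rmorphN /=; ring.
  apply: ltr_wnDr.
    apply: sumr_le0 => j _; rewrite term oppr_le0.
    have [->|/Gup ?] := eqVneq j i0; first by rewrite c1i0 normr0 expr0n mulr0.
    by rewrite mulr_ge0// ?ler0c ?subr_ge0 ?ltW// exprn_gt0.
  rewrite term oppr_lt0 mulr_gt0 ?exprn_gt0 ?normr_gt0//.
  rewrite ltcR subr_gt0 Gup//; apply: contraNneq c1k => ->.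
  by rewrite c1i0.
case: (@arg_minP _ R _ j1 (fun j => j != i0) G j1i0) => j2 j2i0 Gmin.
have nG j : j != i0 -> `|D 0 j| = (G j)%:C.
  move=> /Glo h; rewrite DG rmorphN normrN ger0_norm// ler0c; lra.
exists (G j2), [seq D 0 j | j <- enum 'I_m & j != i0]; split.
- by rewrite Glo//= (le_trans _ Gj1)// Gmin.
- rewrite (@char_poly_intertwined _ _ P _ (diag_mx D))//; last first.
    by rewrite [in LHS]NE !mulmxA PPt mul1mx.
  rewrite char_poly_diag_mx (bigD1 i0)//= Di0 big_cons; congr (_ * _).
  by rewrite big_map big_filter big_enum_cond.
- exists (D 0 j2); last exact: nG.
  by apply/mapP; exists j2 => //; rewrite mem_filter j2i0 mem_enum.
- move=> l /mapP[j]; rewrite mem_filter => /andP[ji0 _] ->.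
  by rewrite nG// lecR Gmin.
Qed.

End hermitian_gap.

(** * Characters of the cycle and the dispersion relation *)

Lemma sin_le_id (R : realType) (x : R) : 0 <= x -> sin x <= x.
Proof.
rewrite le_eqVlt => /predU1P[<-|x0]; first by rewrite sin0.
have [c _] : exists2 c, c \in `]0, x[ & sin x - sin 0 = cos c * (x - 0).
  by apply: MVT => //; exact/continuous_subspaceT/continuous_sin.
rewrite sin0 !subr0 => ->.
by rewrite ler_piMl ?cos_le1 ?ltW.
Qed.

Section characters.
Context {R : realType} {m : nat}.
Local Notation C := R[i].
Local Notation n := m.+3.
Local Notation I := 'I_m.+3.

Let n_gt0 : 0 < n%:R :> R. Proof. by rewrite ltr0n. Qed.

Definition angle : R := 2 * pi / n%:R.

(** The character value exp (2 pi i k / n) of the cyclic group. Taking n = m + 3 makes ['I_n] a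
    nontrivial ring in which 2 is nonzero. *)
Definition chi (k : I) : C := (cos (angle * k%:R)) +i* (sin (angle * k%:R)).

Let chi_val (j : nat) : (cos (angle * j%:R)) +i* (sin (angle * j%:R)) =
  (cos angle +i* sin angle) ^+ j :> C.
Proof.
elim: j => [|j IH]; first by rewrite mulr0 cos0 sin0.
rewrite exprS -IH -natr1 mulrDr mulr1 cosD sinD.
apply/eqP; rewrite eq_complex /=; apply/andP; split; apply/eqP; ring.
Qed.

Let zeta_n : (cos angle +i* sin angle) ^+ n = 1 :> C.
Proof.
rewrite -chi_val /angle divfK ?gt_eqF// mulr_natl.
by rewrite cos2pi sin2pi.
Qed.

Lemma chi_mod (j : nat) : chi (inZp j) = (cos angle +i* sin angle) ^+ j.
Proof.
rewrite /chi chi_val /= [in RHS](divn_eq j n) exprD mulnC exprM zeta_n expr1n.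
by rewrite mul1r.
Qed.

Lemma chiD k l : chi (k + l) = chi k * chi l.
Proof. have -> : k + l = inZp (k + l)%N by exact: val_inj.
by rewrite chi_mod exprD /chi !chi_val. Qed.

Lemma chi0 : chi 0 = 1.
Proof. by rewrite /chi mulr0 cos0 sin0. Qed.

Lemma chi_normK k : chi k * (chi k)^* = 1.
Proof.
apply/eqP; rewrite eq_complex /=; apply/andP; split; apply/eqP; last by ring.
move: (cos2Dsin2 (angle * k%:R)); move: (cos _) (sin _) => c s <-; ring.
Qed.

Lemma norm_chi k : `|chi k| = 1.
Proof. by rewrite normc_def /= cos2Dsin2 sqrtr1. Qed.

Lemma chi_neq0 k : chi k != 0.
Proof. by rewrite -normr_eq0 norm_chi oner_eq0. Qed.

Lemma chiN k : chi (- k) = (chi k)^*.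
Proof.
apply: (mulfI (chi_neq0 k)).
by rewrite -chiD subrr chi0 chi_normK.
Qed.

(** For y = pi k / n strictly between 0 and pi, the real part is 1 - 2 sin^2 y < 1. *)
Lemma chi_eq1 k : (chi k == 1) = (k == 0).
Proof.
apply/idP/eqP => [|->]; last by rewrite chi0.
apply: contraTeq => k0; rewrite eq_complex /= negb_and; apply/orP; left.
have kn : (k%:R : R) < n%:R by rewrite ltr_nat.
have k1 : 0 < k%:R :> R by rewrite ltr0n lt0n.
set y : R := pi * k%:R / n%:R.
have -> : angle * k%:R = y *+ 2 by rewrite /angle /y -mulr_natl; ring.
have y0 : 0 < sin y.
  apply: sin_gt0_pi; rewrite /y divr_gt0 ?mulr_gt0 ?pi_gt0//=.
  by rewrite ltr_pdivrMr// ltr_pM2l ?pi_gt0.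
by rewrite cos_mulr2n cos2sin2; apply/eqP => h; nra.
Qed.

(** Shifting the index by 1 multiplies the sum by [chi k], which differs from 1 unless k = 0. *)
Lemma sum_chi k : \sum_(j : I) chi (k * j) = (if k == 0 then n%:R else 0).
Proof.
case: eqVneq => [->|k0].
  under eq_bigr do rewrite mul0r chi0.
  by rewrite sumr_const card_ord.
have : \sum_(j : I) chi (k * j) = chi k * \sum_(j : I) chi (k * j).
  rewrite [LHS](reindex_inj (addrI 1)) mulr_sumr.
  by apply: eq_bigr => j _; rewrite mulrDr mulr1 chiD.
move/eqP; rewrite -subr_eq0 -[X in X - _]mul1r -mulrBl mulf_eq0 subr_eq0 eq_sym.
by rewrite chi_eq1 (negbTE k0) => /eqP.
Qed.

Let chi_mul_val k (j : I) : chi (k * j) = chi k ^+ j.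
Proof. have -> : k * j = inZp (k * j)%N by exact: val_inj.
by rewrite chi_mod exprM /chi !chi_val. Qed.

Let norm_1Bexp (w : C) j : `|w| = 1 -> `|1 - w ^+ j| <= j%:R * `|1 - w|.
Proof.
move=> w1; elim: j => [|j IH]; first by rewrite subrr normr0 mul0r.
have -> : 1 - w ^+ j.+1 = (1 - w ^+ j) + w ^+ j * (1 - w) by rewrite exprS; ring.
apply: (le_trans (ler_normD _ _)); rewrite normrM normrX w1 expr1n mul1r.
by rewrite -natr1 mulrDl mul1r lerD2r.
Qed.

(* The powers of w = chi k sum to 0, so n = sum_j (1 - w^j), and |1 - w^j| <= j |1 - w|. *)
Lemma norm_1Bchi_ge k : k != 0 -> (n%:R^-1)%:C <= `|1 - chi k|.
Proof.
move=> k0; have S0 := sum_chi k; rewrite (negbTE k0) in S0.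
have hn : (n%:R : C) = \sum_(j : I) (1 - chi k ^+ j).
  rewrite sumrB sumr_const card_ord.
  by under [X in _ - X]eq_bigr do rewrite -chi_mul_val; rewrite S0 subr0.
have : (n%:R : C) <= n%:R * (n%:R * `|1 - chi k|).
  rewrite [X in X <= _](_ : _ = `|\sum_(j : I) (1 - chi k ^+ j)|); last first.
    by rewrite -hn ger0_norm ?ler0n.
  apply: (le_trans (ler_norm_sum _ _ _)).
  apply: (@le_trans _ _ (\sum_(j : I) n%:R * `|1 - chi k|)).
    apply: ler_sum => j _; apply: (le_trans (norm_1Bexp _ _ (norm_chi k))).
    by rewrite ler_wpM2r// ler_nat ltnW.
  by rewrite sumr_const card_ord -[leLHS]mulr_natl.
have nC : 0 < n%:R :> C by rewrite ltr0n.
rewrite -[X in X <= _]mulr1 ler_pM2l// -ler_pdivrMl// mulr1.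
by rewrite rmorphV ?unitfE ?gt_eqF//= rmorph_nat.
Qed.

(** With y = pi / n the chord has length 2 sin y <= 2 y. *)
Lemma norm_1Bchi1_le : `|1 - chi 1| <= (2 * pi / n%:R)%:C.
Proof.
rewrite normc_def lecR.
have a0 : 0 <= 2 * pi / n%:R :> R.
  by rewrite divr_ge0 ?mulr_ge0 ?pi_ge0 ?ltW.
rewrite -[leRHS]ger0_norm// -sqrtr_sqr ler_wsqrtr//=.
set y : R := pi / n%:R.
rewrite modn_small//.
rewrite /angle (_ : 2 * pi / n%:R * _ = y *+ 2); last first.
  by rewrite /y -mulr_natl; rewrite mulr1; ring.
have -> : 2 * pi / n%:R = 2 * y :> R by rewrite /y; ring.
have y0 : 0 <= y by rewrite divr_ge0 ?pi_ge0 ?ltW.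
have ypi : y <= pi.
  by rewrite ler_pdivrMr// ler_peMr ?pi_ge0// ler1n.
have s0 : 0 <= sin y by apply: sin_ge0_pi; rewrite y0.
have sy := sin_le_id _ _ y0.
rewrite cos_mulr2n sin_mulr2n; have := cos2Dsin2 y.
set c := cos y; set s := sin y; rewrite -/s in s0 sy => cs.
have -> : (1 - (c ^+ 2 *+ 2 - 1)) ^+ 2 + (0 - (c * s) *+ 2) ^+ 2 =
   4 * (1 - c ^+ 2) ^+ 2 + 4 * c ^+ 2 * s ^+ 2 by ring.
have -> : 1 - c ^+ 2 = s ^+ 2 by rewrite -cs; ring.
have -> : 4 * (s ^+ 2) ^+ 2 + 4 * c ^+ 2 * s ^+ 2 = 4 * s ^+ 2 * (c ^+ 2 + s ^+ 2) by ring.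
by rewrite cs; nra.
Qed.

Definition energy (k : I) : R := 2 * complex.Re (chi k).

Lemma energyE k : (energy k)%:C = chi k + (chi k)^*.
Proof. by rewrite addcJ /energy rmorphM /= rmorph_nat. Qed.

Lemma energy_le2 k : `|energy k| <= 2.
Proof. by rewrite normrM ger0_norm// ler_piMr// cos_max. Qed.

Let energyBE k l t : (energy (k + t) - energy (l + t))%:C =
  (chi k - chi l) * chi t + ((chi k - chi l) * chi t)^*.
Proof.
rewrite rmorphB /= !energyE !chiD !rmorphM rmorphB /=; ring.
Qed.

Let two_neq0 : (1 + 1 : I) != 0.
Proof. by rewrite -val_eqE /= ?modn_small. Qed.

Let chi_double t : chi t ^+ 2 = chi ((1 + 1) * t).
Proof. by rewrite mulrDl mul1r chiD. Qed.

(** For c = chi k - chi l each difference is c chi t plus its conjugate. In its square the terms in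
    chi (2 t) sum to zero because 2 is nonzero modulo n, and 2 |c|^2 remains for each t. *)
Lemma sum_energyB_sqr k l :
  (\sum_t (energy (k + t) - energy (l + t)) ^+ 2)%:C =
  2 * n%:R * `|chi k - chi l| ^+ 2.
Proof.
set c := chi k - chi l.
rewrite rmorph_sum /=.
under eq_bigr => t _.
  rewrite rmorphXn /= energyBE -/c.
  have -> : (c * chi t + (c * chi t)^*) ^+ 2 =
      c ^+ 2 * chi ((1 + 1) * t) + (c ^+ 2 * chi ((1 + 1) * t))^* + 2 * `|c| ^+ 2.
    rewrite -chi_double sqr_normc.
    have -> : (c * chi t)^* = c^* * (chi t)^* by rewrite rmorphM.
    have -> : (c ^+ 2 * chi t ^+ 2)^* = c^* ^+ 2 * (chi t)^* ^+ 2.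
      by rewrite !expr2 !rmorphM.
    have := chi_normK t; set x := chi t; set y := x^*; move=> xy.
    transitivity (c ^+ 2 * x ^+ 2 + c^* ^+ 2 * y ^+ 2 + 2 * (c * c^*) * (x * y)); first by ring.
    by rewrite xy mulr1.
  over.
rewrite !big_split /= -!rmorph_sum -!mulr_sumr sum_chi (negbTE two_neq0).
by rewrite mulr0 rmorph0 !add0r sumr_const card_ord -mulr_natl; ring.
Qed.

Lemma sum_energyB k l : \sum_t (energy (k + t) - energy (l + t)) = 0.
Proof.
apply/eqP; rewrite sumrB subr_eq0; apply/eqP.
transitivity (\sum_t energy t); first by rewrite [RHS](reindex_inj (addrI k)).
by rewrite [LHS](reindex_inj (addrI l)).
Qed.

(** The differences E_(k+t) - E_(l+t) sum to zero over t, so subtracting the constant d can only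
    increase the sum of squares. What remains is 2 n |1 - chi (l - k)|^2 >= 2 n n^-2. *)
Lemma energy_dispersion_ge k l : k != l -> 2 / n%:R <=
  \sum_t ((energy (k + t) - energy k) - (energy (l + t) - energy l)) ^+ 2.
Proof.
move=> kl.
set d := energy k - energy l.
have -> : \sum_t ((energy (k + t) - energy k) - (energy (l + t) - energy l)) ^+ 2
   = \sum_t (energy (k + t) - energy (l + t)) ^+ 2 + n%:R * d ^+ 2.
  transitivity (\sum_t ((energy (k + t) - energy (l + t)) ^+ 2
     - 2 * d * (energy (k + t) - energy (l + t)) + d ^+ 2)).
    by apply: eq_bigr => t _; rewrite /d; ring.
  rewrite !big_split /= sumrN -mulr_sumr sum_energyB mulr0 oppr0 addr0.
  by rewrite sumr_const card_ord mulr_natl.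
apply: (@le_trans _ _ (\sum_t (energy (k + t) - energy (l + t)) ^+ 2)); last first.
  by rewrite lerDl mulr_ge0 ?sqr_ge0 ?ltW.
rewrite -lecR sum_energyB_sqr.
have -> : chi k - chi l = chi k * (1 - chi (l - k)).
  by rewrite mulrBr mulr1 -chiD (addrC k) subrK.
rewrite normrM norm_chi mul1r.
have := @norm_1Bchi_ge (l - k); rewrite subr_eq0 eq_sym => /(_ kl) h.
have nC : 0 < n%:R :> C by rewrite ltr0n.
have -> : (2 / n%:R : R)%:C = 2 * n%:R * (n%:R^-1)%:C ^+ 2 :> C.
  rewrite rmorphM !rmorphV ?unitfE ?gt_eqF//= !rmorph_nat.
  by field; rewrite gt_eqF.
rewrite ler_pM2l ?mulr_gt0// lerXn2r// nnegrE// ler0c invr_ge0 ltW//.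
Qed.

(** Consecutive energies differ by at most 2 |1 - chi 1| <= 4 pi / n, and two such differences
    enter. *)
Lemma energyB_succ_le k t :
  `|(energy (k + t) - energy k) - (energy (k + 1 + t) - energy (k + 1))| <=
  8 * pi / n%:R.
Proof.
have D s : `|energy (k + s) - energy (k + 1 + s)| <= 4 * pi / n%:R.
  rewrite -lecR.
  have -> : `|energy (k + s) - energy (k + 1 + s)|%:C =
      `|(energy (k + s) - energy (k + 1 + s))%:C|.
    by rewrite normc_def /= expr0n /= addr0 sqrtr_sqr.
  rewrite energyBE; apply: (le_trans (ler_normD _ _)).
  rewrite normcJ normrM norm_chi mulr1 chiD -[X in X - _]mulr1 -mulrBr normrM.
  rewrite norm_chi mul1r; have := norm_1Bchi1_le.
  have -> : (4 * pi / n%:R)%:C = (2 * pi / n%:R)%:C + (2 * pi / n%:R)%:C :> C.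
    by rewrite -rmorphD /=; congr (_%:C); ring.
  by move=> h; exact: lerD.
have := D t; have := D 0; rewrite !addr0 !ler_norml => /andP[a1 a2] /andP[b1 b2].
have -> : 8 * pi / n%:R = 2 * (4 * pi / n%:R) :> R by ring.
move: (4 * pi / n%:R) (energy (k + t)) (energy k) (energy (k + 1 + t))
  (energy (k + 1)) a1 a2 b1 b2 => A x1 x2 x3 x4 a1 a2 b1 b2.
by apply/andP; split; lra.
Qed.
End characters.

(** * The Lindbladian in an eigenbasis of the Hamiltonian *)

(** Together with the next lemma this collapses the sums over energies and Bohr frequencies: a
    matrix entry in the eigenbasis selects at most one of them. *)
Lemma fset_set_sum_delta (V : nmodType) (T : choiceType) (S : set T) (x : T)
    (F : T -> V) : finite_set S -> S x ->
  \sum_(t <- fset_set S) (if x == t then F t else 0) = F x.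
Proof.
move=> fS Sx; rewrite (bigD1_seq x)/= ?fset_uniq//; last first.
  by rewrite in_fset_set// inE.
rewrite eqxx big1 ?addr0// => t; rewrite eq_sym => /negbTE ->//.
Qed.

Lemma fset_set_sum_out (V : nmodType) (T : choiceType) (S : set T) (x : T)
    (F : T -> V) : finite_set S -> ~ S x ->
  \sum_(t <- fset_set S) (if x == t then F t else 0) = 0.
Proof.
move=> fS Sx; apply: big1_seq => t /andP[_]; rewrite in_fset_set// inE => St.
by case: eqP => // xt; rewrite xt in Sx.
Qed.

(** * Sesquilinearity of the dissipator and its values on matrix units *)

Section sandwiches.
Context {C : numClosedFieldType} {n : nat}.
Implicit Types (D E X : 'M[C]_n).

(* Polarization of the dissipator: [dissipator L X = bidissipator L L X]. *)
Definition bidissipator D E X : 'M[C]_n :=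
  D *m X *m E^t* - 2^-1 *: (E^t* *m D *m X + X *m (E^t* *m D)).

Lemma bidissipator_suml (J : Type) (r : seq J) (D : J -> 'M[C]_n) E X :
  bidissipator (\sum_(j <- r) D j) E X = \sum_(j <- r) bidissipator (D j) E X.
Proof.
rewrite /bidissipator sumrB -scaler_sumr big_split /=.
by rewrite !(mulmx_suml, mulmx_sumr).
Qed.

Lemma bidissipator_sumr (J : Type) (r : seq J) D (E : J -> 'M[C]_n) X :
  bidissipator D (\sum_(j <- r) E j) X = \sum_(j <- r) bidissipator D (E j) X.
Proof.
rewrite /bidissipator.
have -> : (\sum_(j <- r) E j)^t* = \sum_(j <- r) (E j)^t*.
  by rewrite raddf_sum /= (raddf_sum (map_mx _)).
rewrite sumrB -scaler_sumr big_split /=.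
by rewrite !(mulmx_suml, mulmx_sumr).
Qed.

Lemma bidissipatorZl a D E X :
  bidissipator (a *: D) E X = a *: bidissipator D E X.
Proof.
rewrite /bidissipator -!(scalemxAl, scalemxAr) -scalerDr.
by rewrite scalerA [_ * a]mulrC -scalerA -scalerBr.
Qed.

Lemma bidissipatorZr a D E X :
  bidissipator D (a *: E) X = a^* *: bidissipator D E X.
Proof.
rewrite /bidissipator linearZ /= map_mxZ -!(scalemxAl, scalemxAr) -scalerDr.
by rewrite scalerA [_ * a^*]mulrC -scalerA -scalerBr.
Qed.

Lemma delta_mul_mxE (i j k l : 'I_n) X :
  (delta_mx i j *m X) k l = (k == i)%:R * X j l.
Proof.
rewrite mxE (bigD1 j)//= big1 ?addr0; first by rewrite mxE eqxx andbT.
by move=> h /negbTE hj; rewrite mxE hj andbF mul0r.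
Qed.

Lemma mul_mx_deltaE (i j k l : 'I_n) X :
  (X *m delta_mx i j) k l = X k i * (l == j)%:R.
Proof.
rewrite mxE (bigD1 i)//= big1 ?addr0; first by rewrite mxE eqxx.
by move=> h /negbTE hj; rewrite mxE hj mulr0.
Qed.

Lemma bidissipator_delta (i j i' j' k l : 'I_n) X :
  bidissipator (delta_mx i j) (delta_mx i' j') X k l =
  (k == i)%:R * X j j' * (l == i')%:R
  - 2^-1 * ((i == i')%:R * (k == j')%:R * X j l
            + (i == i')%:R * X k j' * (l == j)%:R).
Proof.
have adj : (delta_mx i' j' : 'M[C]_n)^t* = delta_mx j' i'.
  by rewrite trmx_delta map_delta_mx.
have dd : delta_mx j' i' *m delta_mx i j = (i == i')%:R *: delta_mx j' j :> 'M[C]_n.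
  apply/matrixP => a b; rewrite delta_mul_mxE !mxE.
  by rewrite [i' == i]eq_sym; case: (a == j'); case: (i == i'); case: (b == j);
    rewrite ?mul1r ?mul0r ?mulr0.
rewrite /bidissipator adj dd -!(scalemxAl, scalemxAr).
have entry (P Q S : 'M[C]_n) a b :
  (P - a *: (b *: Q + b *: S)) k l = P k l - a * (b * Q k l + b * S k l) by rewrite !mxE.
by rewrite entry !mul_mx_deltaE !delta_mul_mxE !mulrA.
Qed.

End sandwiches.

(** * Entrywise integration of finite sums of matrices *)

Section integral_mx.
Context {R : realType} {n : nat}.
Local Notation C := R[i].
Local Notation mu := (@lebesgue_measure R).

(** Integrability goes through the same induction as the value, because additivity of the integral
    requires it. *)
Lemma Rintegral_sum (J : Type) (r : seq J) (g : J -> R -> R) (c : J -> R) :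
  (forall j, mu.-integrable setT (EFin \o g j)) ->
  mu.-integrable setT (EFin \o (fun w => \sum_(j <- r) g j w * c j)) /\
  \int[mu]_(w in setT) (\sum_(j <- r) g j w * c j) =
  \sum_(j <- r) (\int[mu]_(w in setT) g j w) * c j.
Proof.
move=> ig; elim: r => [|j r [IH1 IH2]].
  split.
    rewrite (_ : (fun w : R => _) = cst 0); last first.
      by apply/funext => w; rewrite big_nil.
    exact: integrable0.
  under eq_Rintegral do rewrite big_nil.
  by rewrite big_nil Rintegral_cst// mul0r.
have igc : mu.-integrable setT (EFin \o (fun w => g j w * c j)).
  rewrite (_ : (fun w => _) = (fun w => c j * g j w)); last first.
    by apply/funext => w; rewrite mulrC.
  by have := ig j; exact: integrableZl.
split.
  rewrite (_ : (fun w => _) = (fun w => g j w * c j + \sum_(j <- r) g j w * c j)); last first.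
    by apply/funext => w; rewrite big_cons.
  exact: (integrableD measurableT igc IH1).
under eq_Rintegral do rewrite big_cons.
by rewrite (RintegralD measurableT igc IH1) IH2 big_cons (RintegralZr _ measurableT (ig j)).
Qed.

Lemma integral_mx_sum (J : finType) (g : J -> R -> R) (M : J -> 'M[C]_n) :
  (forall j, mu.-integrable setT (EFin \o g j)) ->
  integral_mx (fun w => \sum_j (g j w)%:C *: M j) =
  \sum_j (\int[mu]_(w in setT) g j w)%:C *: M j.
Proof.
move=> ig; apply/matrixP => i k; rewrite !mxE summxE.
have ReE w : complex.Re ((\sum_j (g j w)%:C *: M j) i k) =
    \sum_j g j w * complex.Re (M j i k).
  rewrite summxE (raddf_sum (@complex.Re R : Rcomplex R -> R)).
  by apply: eq_bigr => j _; rewrite mxE; case: (M j i k) => a b /=; rewrite mul0r subr0.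
have ImE w : complex.Im ((\sum_j (g j w)%:C *: M j) i k) =
    \sum_j g j w * complex.Im (M j i k).
  rewrite summxE (raddf_sum (@complex.Im R : Rcomplex R -> R)).
  by apply: eq_bigr => j _; rewrite mxE; case: (M j i k) => a b /=; rewrite mul0r addr0.
under eq_Rintegral do rewrite ReE.
under [X in _ +i* X]eq_Rintegral do rewrite ImE.
rewrite (Rintegral_sum _ _ _ _ ig).2 (Rintegral_sum _ _ _ _ ig).2.
apply/eqP; rewrite eq_complex; apply/andP; split; apply/eqP.
  rewrite (raddf_sum (@complex.Re R : Rcomplex R -> R)).
  by apply: eq_bigr => j _; rewrite mxE; case: (M j i k) => a b /=; rewrite mul0r subr0.
rewrite (raddf_sum (@complex.Im R : Rcomplex R -> R)).
by apply: eq_bigr => j _; rewrite mxE; case: (M j i k) => a b /=; rewrite mul0r addr0.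
Qed.

End integral_mx.

(** * Spectral projectors, Bohr components and the Gibbs weight in an eigenbasis *)

Section eigenbasis.
Context {R : realType} {n : nat}.
Local Notation C := R[i].
Variables (H U : 'M[C]_n) (e : 'I_n -> R).
Hypothesis U_unitary : U \is unitarymx.
Hypothesis U_diag : U *m H = diag_mx (\row_k (e k)%:C) *m U.

(** The rows of [U] are eigenvectors, with [e k] the energy of row [k]. Values of [e] may repeat, as
    they do on the cycle, where k and - k have the same energy. *)
Definition in_eigenbasis (A : 'M[C]_n) := U *m A *m U^t*.
Local Notation hat := in_eigenbasis.

Let UUt : U *m U^t* = 1%:M. Proof. exact/unitarymxP. Qed.

Let UtU : U^t* *m U = 1%:M.
Proof. by rewrite -invmx_unitary// mulVmx// unitarymx_unit. Qed.

Lemma in_eigenbasisM A B : hat (A *m B) = hat A *m hat B.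
Proof. by rewrite /hat !mulmxA -(mulmxA _ (U^t*) U) UtU mulmx1. Qed.

Lemma in_eigenbasis_adjoint A : hat (A^t*) = (hat A)^t*.
Proof. by rewrite /hat !trmx_mul !map_mxM trmxCK mulmxA. Qed.

Lemma in_eigenbasis_inj A B : hat A = hat B -> A = B.
Proof.
move=> /(congr1 (fun X => U^t* *m X *m U)).
by rewrite /hat !mulmxA UtU !mul1mx -!mulmxA UtU !mulmx1.
Qed.

Let hat_sum (J : Type) (r : seq J) (M : J -> 'M[C]_n) :
  hat (\sum_(j <- r) M j) = \sum_(j <- r) hat (M j).
Proof. by rewrite /hat mulmx_sumr mulmx_suml. Qed.

Lemma in_eigenbasisZ a A : hat (a *: A) = a *: hat A.
Proof. by rewrite /hat -scalemxAr -scalemxAl. Qed.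

Let hatZE a A k l : hat (a *: A) k l = a * hat A k l.
Proof. by rewrite in_eigenbasisZ; move: (hat A) => M; rewrite mxE. Qed.

Let hatD A B : hat (A + B) = hat A + hat B.
Proof. by rewrite /hat mulmxDr mulmxDl. Qed.

Let hatB A B : hat (A - B) = hat A - hat B.
Proof. by rewrite /hat mulmxBr mulmxBl. Qed.

Lemma energiesP E : energies H E <-> exists k, e k = E.
Proof.
rewrite /energies /= eigenvalue_root_char.
rewrite (char_poly_intertwined _ _ _ _ _ (unitarymx_unit U_unitary) U_diag).
rewrite char_poly_diag_mx /root horner_prod; split.
  move=> /prodf_eq0[k _]; rewrite !hornerE mxE subr_eq0 => /eqP/complexI ->.
  by exists k.
move=> [k <-]; rewrite (bigD1 k)//= !hornerE mxE subrr mul0r//.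
Qed.

Lemma bohr_frequenciesP k l : bohr_frequencies H (e k - e l).
Proof.
by exists (e k); [apply/energiesP; exists k|exists (e l) => //; apply/energiesP; exists l].
Qed.

Let H_selfadjoint : H^t* = H.
Proof.
have HE : H = U^t* *m diag_mx (\row_k (e k)%:C) *m U.
  by rewrite -mulmxA -U_diag mulmxA UtU mul1mx.
rewrite HE !trmx_mul !map_mxM trmxCK mulmxA; congr (_ *m _ *m _).
rewrite tr_diag_mx map_diag_mx; congr diag_mx.
by apply/rowP => k; rewrite !mxE; exact: conjc_real.
Qed.

(** Rows of [U] with energy E lie in the eigenspace and are fixed by the projector; the others are
    orthogonal to it, H being self-adjoint, and are sent to 0. *)
Lemma in_eigenbasis_projector E :
  hat (spectral_projector H E) = diag_mx (\row_k (e k == E)%:R).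
Proof.
suff UP : U *m spectral_projector H E = diag_mx (\row_k (e k == E)%:R) *m U.
  by rewrite /hat UP -mulmxA UUt mulmx1.
have rowUH k : row k U *m H = (e k)%:C *: row k U.
  by apply/rowP => j; rewrite -row_mul U_diag mul_diag_mx !mxE.
apply/row_matrixP => k; rewrite row_mul.
have -> : row k (diag_mx (\row_k (e k == E)%:R) *m U) = (e k == E)%:R *: row k U.
  by apply/rowP => j; rewrite mul_diag_mx !mxE.
have [ekE|ekE] := eqVneq (e k) E.
  rewrite scale1r; apply: proj_ortho_id; apply/eigenspaceP.
  by rewrite rowUH ekE.
rewrite scale0r; apply: proj_ortho_0.
apply/orthomx1P; set V := eigenspace H E%:C.
have VH : V *m H = E%:C *: V by apply/eigenspaceP.
have HV : H *m V^t* = E%:C *: V^t*.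
  rewrite -{1}H_selfadjoint -map_mxM -trmx_mul VH linearZ /= map_mxZ.
  by congr (_ *: _); exact: conjc_real.
have : ((e k)%:C - E%:C) *: (row k U *m V^t*) = 0.
  by rewrite scalerBl scalemxAl -rowUH -mulmxA HV -scalemxAr subrr.
move/eqP; rewrite scaler_eq0 subr_eq0 => /orP[/eqP/complexI/eqP|/eqP//].
by rewrite (negbTE ekE).
Qed.

Let hat_sandwich P Q A (d d' : 'I_n -> C) k l :
  hat P = diag_mx (\row_k d k) -> hat Q = diag_mx (\row_k d' k) ->
  hat (P *m A *m Q) k l = d k * hat A k l * d' l.
Proof.
move=> hP hQ; rewrite (in_eigenbasisM (P *m A)) (in_eigenbasisM P) hP hQ.
by move: (hat A) => M; rewrite mul_mx_diag mxE mul_diag_mx !mxE.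
Qed.

Lemma in_eigenbasis_bohr A nu k l :
  hat (bohr_component H A nu) k l = if e k - e l == nu then hat A k l else 0.
Proof.
rewrite /bohr_component.
set S := [set EE : R * R | _].
have fS : finite_set S.
  apply: (@sub_finite_set _ _ (energies H `*` energies H)).
    by move=> [E E'] [h1 h2 _]; split.
  by apply: finite_setX; exact: finite_energies.
rewrite fsbig_finite//= hat_sum summxE.
under eq_bigr => EE _.
  rewrite (hat_sandwich _ _ _ _ _ _ _ (in_eigenbasis_projector _)
    (in_eigenbasis_projector _)).
  rewrite (_ : _ * _ = if (e k, e l) == EE then hat A k l else 0); last first.
    by case: EE => E E' /=; rewrite xpair_eqE; case: (e k == E); case: (e l == E');
      rewrite ?mul1r ?mul0r ?mulr1 ?mulr0.
  over.
have [enu|nE] := eqVneq (e k - e l) nu.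
  by rewrite (fset_set_sum_delta _ _ _ _ (fun=> hat A k l))//; split => //=;
    apply/energiesP; [exists k|exists l].
by rewrite (fset_set_sum_out _ _ _ _ (fun=> hat A k l))// => -[_ _ /= h]; rewrite h eqxx in nE.
Qed.

Lemma in_eigenbasis_bohr_sum A (c : R -> C) k l :
  hat (\sum_(nu \in bohr_frequencies H) c nu *: bohr_component H A nu) k l =
  c (e k - e l) * hat A k l.
Proof.
rewrite fsbig_finite//=; last exact: finite_bohr_frequencies.
rewrite hat_sum summxE.
under eq_bigr => nu _.
  rewrite in_eigenbasisZ mxE in_eigenbasis_bohr.
  rewrite (_ : _ * _ = if e k - e l == nu then c nu * hat A k l else 0); last first.
    by case: ifP => _ //; rewrite mulr0.
  over.
rewrite (fset_set_sum_delta _ _ _ _ (fun nu => c nu * hat A k l))//.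
  exact: finite_bohr_frequencies.
exact: bohr_frequenciesP.
Qed.

Lemma in_eigenbasis_boltzmann beta :
  hat (boltzmann H beta) = diag_mx (\row_k (expR (- beta * e k))%:C).
Proof.
rewrite /boltzmann fsbig_finite//=; last exact: finite_energies.
apply/matrixP => k l; rewrite hat_sum summxE [RHS]mxE mxE.
under eq_bigr => E _.
  rewrite in_eigenbasisZ in_eigenbasis_projector !mxE.
  rewrite (_ : _ * _ = if e k == E then (expR (- beta * E))%:C *+ (k == l) else 0); last first.
    by case: (e k == E); rewrite mulrnAr ?mulr1// mulr0 mul0rn.
  over.
rewrite (fset_set_sum_delta _ _ _ _ (fun E => (expR (- beta * E))%:C *+ (k == l)))//.
  exact: finite_energies.
by apply/energiesP; exists k.
Qed.

(** * Matrix entries of the Lindbladian when the cross terms cancel *)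

Section lindbladian.
Variables (beta sigma : R) (I : finType) (A : I -> 'M[C]_n).
Hypothesis sigma_gt0 : 0 < sigma.
Hypothesis beta_gt0 : 0 < beta.

(* Only pairs with nu1 = nu2 then survive in B, and tanh vanishes there. *)
Hypothesis cross_terms_cancel : forall k k' l, k != k' ->
  \sum_a (hat (A a) l k)^* * hat (A a) l k' = 0.

Lemma coherent_term_eq0 : coherent_term H beta sigma A = 0.
Proof.
apply: in_eigenbasis_inj; apply/matrixP => k k'.
rewrite [in RHS]/hat mulmx0 mul0mx [RHS]mxE /coherent_term hat_sum summxE.
set c := fun nu1 nu2 => (tanh (- beta * (nu1 - nu2) / 4))%:C / (2 * 'i%C)
  * (theta beta sigma nu1 nu2)%:C.
have fB := finite_bohr_frequencies H.
(* Once the intermediate index [l] of the matrix product is fixed, both Bohr frequencies are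
   determined. *)
transitivity (\sum_a \sum_l c (e l - e k') (e l - e k) *
    ((hat (A a) l k)^* * hat (A a) l k')); last first.
  rewrite exchange_big big1// => l _; rewrite -mulr_sumr.
  have [->|kk'] := eqVneq k k'; last by rewrite cross_terms_cancel// mulr0.
  by rewrite /c subrr mulr0 mul0r /tanh oppr0 subrr !mul0r.
apply: eq_bigr => a _.
rewrite fsbig_finite//= hat_sum summxE.
under [LHS]eq_bigr => nu1 _.
  rewrite fsbig_finite//= hat_sum summxE.
  under eq_bigr => nu2 _.
    rewrite in_eigenbasisZ mxE in_eigenbasisM in_eigenbasis_adjoint [X in _ * X]mxE.
    rewrite mulr_sumr.
    under eq_bigr => l _.
      rewrite 2!mxE !in_eigenbasis_bohr.
      rewrite (_ : _ * _ = if e l - e k == nu2 then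
        if e l - e k' == nu1 then c nu1 nu2 * ((hat (A a) l k)^* * hat (A a) l k')
        else 0 else 0); last first.
        case: (_ == nu2); last by rewrite rmorph0 mul0r mulr0.
        by case: (_ == nu1); rewrite ?mulr0.
      over.
    over.
  rewrite exchange_big /=.
  under eq_bigr => l _.
    rewrite (fset_set_sum_delta _ _ _ _ (fun nu2 => if e l - e k' == nu1
      then c nu1 nu2 * ((hat (A a) l k)^* * hat (A a) l k') else 0))//;
      last exact: bohr_frequenciesP.
    over.
  over.
rewrite exchange_big /=; apply: eq_bigr => l _.
by rewrite (fset_set_sum_delta _ _ _ _ (fun nu1 =>
  c nu1 (e l - e k) * ((hat (A a) l k)^* * hat (A a) l k')))//;
  exact: bohr_frequenciesP.
Qed.

Lemma dissipatorE (L X : 'M[C]_n) : dissipator L X = bidissipator L L X.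
Proof. by []. Qed.

Let unit_jump (p : 'I_n * 'I_n) : 'M[C]_n := U^t* *m delta_mx p.1 p.2 *m U.

Let hat_unit_jump p : hat (unit_jump p) = delta_mx p.1 p.2.
Proof. by rewrite /hat /unit_jump !mulmxA UUt mul1mx -mulmxA UUt mulmx1. Qed.

Let bohr (p : 'I_n * 'I_n) : R := e p.1 - e p.2.

Lemma filtered_jump_expansion a w : filtered_jump H sigma A a w =
  \sum_p ((fhat sigma (w - bohr p))%:C * hat (A a) p.1 p.2) *: unit_jump p.
Proof.
apply: in_eigenbasis_inj; apply/matrixP => k l.
rewrite in_eigenbasis_bohr_sum hat_sum summxE (bigD1 (k, l))//= big1.
  have d : (delta_mx k l : 'M[C]_n) k l = 1 by rewrite mxE !eqxx.
  by rewrite hatZE hat_unit_jump d mulr1 addr0.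
move=> [i j] ij; rewrite hatZE hat_unit_jump.
have -> : (delta_mx i j : 'M[C]_n) k l = 0.
  by rewrite mxE [k == i]eq_sym [l == j]eq_sym -xpair_eqE (negbTE ij).
by rewrite mulr0.
Qed.

Lemma in_eigenbasis_bidissipator D E X :
  hat (bidissipator D E X) = bidissipator (hat D) (hat E) (hat X).
Proof.
by rewrite /bidissipator hatB in_eigenbasisZ hatD !in_eigenbasisM in_eigenbasis_adjoint.
Qed.

Let weight (q : ('I_n * 'I_n) * ('I_n * 'I_n)) (w : R) : R :=
  gamma beta sigma w * fhat sigma (w - bohr q.1) * fhat sigma (w - bohr q.2).

Let integrable_weight q :
  (@lebesgue_measure R).-integrable setT (EFin \o weight q).
Proof. exact: integrable_theta_integrand. Qed.

(** Expanding both copies of the filtered jump in matrix units of the eigenbasis leaves [omega] only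
    in scalar weights gamma f f, whose integrals are the values of [theta]. *)
Lemma integral_dissipator a X :
  integral_mx (fun w => (gamma beta sigma w)%:C *:
                        dissipator (filtered_jump H sigma A a w) X) =
  \sum_q ((theta beta sigma (bohr q.1) (bohr q.2))%:C
    * (hat (A a) q.1.1 q.1.2 * (hat (A a) q.2.1 q.2.2)^*))
    *: bidissipator (unit_jump q.1) (unit_jump q.2) X.
Proof.
transitivity (integral_mx (fun w => \sum_q (weight q w)%:C *:
   ((hat (A a) q.1.1 q.1.2 * (hat (A a) q.2.1 q.2.2)^*) *:
     bidissipator (unit_jump q.1) (unit_jump q.2) X))).
  congr integral_mx; apply/funext => w.
  rewrite dissipatorE filtered_jump_expansion bidissipator_suml scaler_sumr.
  rewrite -(pair_bigA _ (fun p q => (weight (p, q) w)%:C *: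
   ((hat (A a) p.1 p.2 * (hat (A a) q.1 q.2)^*) *:
     bidissipator (unit_jump p) (unit_jump q) X))) /=.
  apply: eq_bigr => p _; rewrite bidissipator_sumr scaler_sumr.
  apply: eq_bigr => q _; rewrite bidissipatorZl bidissipatorZr !scalerA.
  congr (_ *: _); rewrite /weight /=.
  move: (gamma _ _ _) (fhat _ _) (fhat _ _) (hat _ _ _) (hat _ _ _) => x y z u v.
  have cr (r : R) : (r%:C : C)^* = r%:C by exact: conjc_real.
  by rewrite !rmorphM /= cr; ring.
rewrite integral_mx_sum; last exact: integrable_weight.
by apply: eq_bigr => q _; rewrite scalerA.
Qed.

(** [T] is the second moment of the jump family. The sandwich term keeps its general form, while the
    anticommutator only rescales each entry. *)
Lemma in_eigenbasis_lindbladian X k l (Y := hat X)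
    (T := fun i j i' j' => \sum_a hat (A a) i j * (hat (A a) i' j')^*) :
  hat (CKG_lindbladian H beta sigma A X) k l =
  (\sum_j \sum_j' (theta beta sigma (e k - e j) (e l - e j'))%:C * T k j l j' * Y j j')
  - 2^-1 * (\sum_i (theta beta sigma (e i - e k) (e i - e k))%:C * T i k i k
            + \sum_i (theta beta sigma (e i - e l) (e i - e l))%:C * T i l i l)
     * Y k l.
Proof.
rewrite /CKG_lindbladian coherent_term_eq0 mul0mx mulmx0 subrr scaler0 add0r.
under eq_bigr do rewrite integral_dissipator.
rewrite exchange_big hat_sum summxE /=.
(* This makes the sum of the products of adjoint and jump diagonal in the eigenbasis. *)
have T0 i j j' : j != j' -> T i j i j' = 0.
  move=> jj'; rewrite /T -[RHS](cross_terms_cancel j' j i) 1?eq_sym//.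
  by apply: eq_bigr => a _; rewrite mulrC.
under eq_bigr => q _.
  rewrite -scaler_suml -mulr_sumr in_eigenbasisZ mxE in_eigenbasis_bidissipator.
  rewrite !hat_unit_jump bidissipator_delta -/Y.
  over.
rewrite -(pair_bigA _ (fun p q => ((theta beta sigma (bohr p) (bohr q))%:C * T p.1 p.2 q.1 q.2) *
   ((k == p.1)%:R * Y p.2 q.2 * (l == q.1)%:R - 2^-1 * ((p.1 == q.1)%:R * (k == q.2)%:R * Y p.2 l
   + (p.1 == q.1)%:R * Y k q.2 * (l == p.2)%:R)))) /=.
rewrite -(pair_bigA _ (fun i j => \sum_q ((theta beta sigma (e i - e j) (bohr q))%:C * T i j q.1 q.2) *
   ((k == i)%:R * Y j q.2 * (l == q.1)%:R - 2^-1 * ((i == q.1)%:R * (k == q.2)%:R * Y j l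
   + (i == q.1)%:R * Y k q.2 * (l == j)%:R)))) /=.
pose g i j i' j' := (theta beta sigma (e i - e j) (e i' - e j'))%:C * T i j i' j'.
transitivity (\sum_i \sum_j \sum_i' \sum_j' (
    (if k == i then if l == i' then g i j i' j' * Y j j' else 0 else 0)
    - 2^-1 * ((if i == i' then if k == j' then g i j i' j' * Y j l else 0 else 0)
             + (if i == i' then if l == j then g i j i' j' * Y k j' else 0 else 0)))).
  apply: eq_bigr => i _; apply: eq_bigr => j _.
  rewrite -(pair_bigA _ (fun i' j' => ((theta beta sigma (e i - e j) (e i' - e j'))%:C * T i j i' j') *
   ((k == i)%:R * Y j j' * (l == i')%:R - 2^-1 * ((i == i')%:R * (k == j')%:R * Y j l
   + (i == i')%:R * Y k j' * (l == j)%:R)))) /=.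
  apply: eq_bigr => i' _; apply: eq_bigr => j' _; rewrite -/(g i j i' j').
  by case: (k == i); case: (l == i'); case: (i == i'); case: (k == j');
    case: (l == j) => /=; ring.
have pick (F : 'I_n -> C) i : \sum_j (if i == j then F j else 0) = F i.
  by rewrite -big_mkcond /= (bigD1 i)//= big1 ?addr0// => j /andP[/eqP ->]; rewrite eqxx.
have pull (b : bool) (F : 'I_n -> C) : \sum_j (if b then F j else 0) = if b then \sum_j F j else 0.
  by case: b => //; rewrite big1.
transitivity ((\sum_j \sum_j' g k j l j' * Y j j')
   - 2^-1 * (\sum_i \sum_j g i j i k * Y j l + \sum_i \sum_j' g i l i j' * Y k j')).
  under eq_bigr => i _.
    under eq_bigr => j _.
      under eq_bigr => i' _.
        rewrite sumrB -mulr_sumr big_split /= !pull !pick.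
        over.
      rewrite sumrB -mulr_sumr big_split /= !pull !pick.
      over.
    rewrite sumrB -mulr_sumr big_split /= !pull.
    over.
  rewrite sumrB -mulr_sumr big_split /= !pick.
  congr (_ - _ * (_ + _)).
  by apply: eq_bigr => i _; rewrite pick.
congr (_ - _); rewrite -mulrA mulrDl !mulr_suml; congr (_ * (_ + _)).
  apply: eq_bigr => i _; rewrite (bigD1 k)//= big1 ?addr0// => j jk.
  by rewrite /g T0// mulr0 mul0r.
apply: eq_bigr => i _; rewrite (bigD1 l)//= big1 ?addr0// => j jl.
by rewrite /g T0 1?eq_sym// mulr0 mul0r.
Qed.

End lindbladian.

End eigenbasis.

(** * The Dirichlet form of the symmetrized generator *)

Section complex_square.
Context {R : realType}.
Implicit Types z : R[i].

Definition sqrnorm z : R := complex.Re z ^+ 2 + complex.Im z ^+ 2.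

Lemma mul_conj_sqrnorm z : z * z^* = (sqrnorm z)%:C.
Proof. by rewrite -normCK -add_Re2_Im2. Qed.

Lemma sqrnorm_ge0 z : 0 <= sqrnorm z.
Proof. by rewrite addr_ge0 ?sqr_ge0. Qed.

Lemma sqrnormZ (x : R) z : sqrnorm (x%:C * z) = x ^+ 2 * sqrnorm z.
Proof. by case: z => a b; rewrite /sqrnorm /=; ring. Qed.

Lemma conjCR (x : R) : (x%:C : R[i])^* = x%:C.
Proof. exact: conjc_real. Qed.

End complex_square.

(** The variance identity. It serves as the Poincare inequality for a chain whose equilibrium flow
    between j and k is a product p_j p_k. *)
Lemma sum_weighted_sqrB (R : comNzRingType) (J : finType) (p x : J -> R) :
  \sum_j \sum_k p j * p k * (x j - x k) ^+ 2 =
  2 * (\sum_j p j) * (\sum_j p j * x j ^+ 2) - 2 * (\sum_j p j * x j) ^+ 2.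
Proof.
transitivity (\sum_j ((p j * x j ^+ 2) * (\sum_k p k) + p j * (\sum_k p k * x k ^+ 2)
    - 2 * (p j * x j) * (\sum_k p k * x k))).
  apply: eq_bigr => j _; rewrite !mulr_sumr -big_split -sumrB.
  by apply: eq_bigr => k _ /=; ring.
rewrite sumrB big_split /= -!mulr_suml -mulr_sumr; ring.
Qed.

Section dirichlet_form.
Context {R : realType} {m : nat}.
Local Notation C := R[i].
Local Notation n := m.+3.
Local Notation I := 'I_m.+3.
Variables (beta : R) (th : R -> R -> R) (e : I -> R).
Hypothesis th_balance : forall a b, th a b = expR (- (beta * (a + b) / 2)) * th (- a) (- b).

Let a (k t : I) : R := e (k + t) - e k.

(** Up to normalization, multiplying by these weights is X |-> rho^(-1/4) X rho^(-1/4), which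
    carries the KMS inner product to the Hilbert-Schmidt one. *)
Let half_weight (k l : I) : R := expR (beta * (e k + e l) / 4).
Local Notation r := half_weight.

(** The Lindbladian of the cycle conjugated by [half_weight]; detailed balance has already been used
    to write the jump rate with [th] at positive arguments. *)
Definition sym_generator (V : 'M[C]_n) : 'M[C]_n := \matrix_(k, l)
  ((n%:R ^- 2)%:C * \sum_t
    ((expR (beta * (a k t + a l t) / 4) * th (a k t) (a l t))%:C * V (k + t) (l + t)
     - ((th (a k t) (a k t) + th (a l t) (a l t)) / 2)%:C * V k l)).

Lemma sym_generator_is_linear : linear sym_generator.
Proof.
move=> c V W; apply/matrixP => k l; rewrite !mxE.
rewrite [X in _ = X + _]mulrCA -[RHS]mulrDr; congr (_ * _).
rewrite mulr_sumr -big_split; apply: eq_bigr => t _; rewrite !mxE /=; ring.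
Qed.

Let aN k t : a (k + t) (- t) = - a k t.
Proof. by rewrite /a addrK opprB. Qed.

Let kappa (k l t : I) : R := expR (beta * (a k t + a l t) / 4) * th (a k t) (a l t).

(** A jump and its reversal have the same symmetrized rate: detailed balance contributes exp (- beta
    (a + b) / 2), which turns the factor exp (beta (a + b) / 4) of the reversed jump into its
    inverse. *)
Let kappaN k l t : kappa (k + t) (l + t) (- t) = kappa k l t.
Proof.
rewrite /kappa !aN [RHS](_ : _ = expR (beta * (a k t + a l t) / 4) *
  (expR (- (beta * (a k t + a l t) / 2)) * th (- a k t) (- a l t))); last first.
  by rewrite -th_balance.
by rewrite mulrA -expRD; congr (expR _ * _); field.
Qed.

Let loss (k l t : I) : R := (th (a k t) (a k t) + th (a l t) (a l t)) / 2.

Let entry i j k l : R := n%:R ^- 2 * \sum_t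
  (kappa k l t * ((k + t == i) && (l + t == j))%:R
   - loss k l t * ((k == i) && (l == j))%:R).

Let sym_generator_delta i j k l :
  sym_generator (delta_mx i j) k l = (entry i j k l)%:C.
Proof.
rewrite mxE rmorphM rmorph_sum; congr (_ * _); apply: eq_bigr => t _.
by rewrite !mxE rmorphB !rmorphM !rmorph_nat.
Qed.

Let entry_sym i j k l : entry i j k l = entry k l i j.
Proof.
rewrite /entry !sumrB; congr (_ * (_ - _)).
  rewrite [RHS](reindex_inj oppr_inj); apply: eq_bigr => t _.
  rewrite !subr_eq [i == _]eq_sym [j == _]eq_sym.
  case: eqP => [<-|_]; last by rewrite !mulr0.
  case: eqP => [<-|_]; last by rewrite !mulr0.
  by rewrite kappaN.
rewrite [i == k]eq_sym [j == l]eq_sym.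
case: eqP => [<-|_]; last by rewrite !big1// => t _; rewrite mulr0.
case: eqP => [<-//|_]; by rewrite !big1// => t _; rewrite mulr0.
Qed.

Lemma sym_generator_hermitian i j k l :
  sym_generator (delta_mx i j) k l = (sym_generator (delta_mx k l) i j)^*.
Proof. by rewrite !sym_generator_delta conjCR entry_sym. Qed.

Definition quad_form (V : 'M[C]_n) : C := \sum_k \sum_l sym_generator V k l * (V k l)^*.

(** The equilibrium flow of a jump, invariant under reversal. By [kappaW] and [thW] it turns the
    jump part of the form into squared differences of [r k l] times [V k l]. *)
Let W k l t : R := expR (- (beta * (e k + e l) / 2)) * th (a k t) (a l t).

Let WN k l t : W (k + t) (l + t) (- t) = W k l t.
Proof.
rewrite /W !aN [in RHS]th_balance mulrA -expRD.
by congr (expR _ * _); rewrite /a; field.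
Qed.

Let kappaW k l t : kappa k l t = W k l t * r k l * r (k + t) (l + t).
Proof.
rewrite [RHS](_ : _ = expR (- (beta * (e k + e l) / 2)) * r k l *
  r (k + t) (l + t) * th (a k t) (a l t)); last by rewrite /W; ring.
rewrite /kappa /r -!expRD.
by congr (expR _ * _); rewrite /a; field.
Qed.

Let thW k l t : th (a k t) (a l t) = W k l t * r k l ^+ 2.
Proof.
rewrite /W /r mulrAC expr2 -!expRD.
by rewrite (_ : _ + _ = 0) ?expR0 ?mul1r//; field.
Qed.

Definition defect k l t : R :=
  (th (a k t) (a k t) + th (a l t) (a l t)) / 2 - th (a k t) (a l t).

(** Reversal of jumps, (k, l, t) |-> (k + t, l + t, - t), is a bijection of the index set. *)
Let sum_shift (F : I -> I -> I -> C) :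
  \sum_k \sum_l \sum_t F k l t = \sum_k \sum_l \sum_t F (k + t) (l + t) (- t).
Proof.
have E (G : I -> I -> I -> C) :
    \sum_k \sum_l \sum_t G k l t = \sum_t \sum_k \sum_l G k l t.
  under eq_bigr do rewrite exchange_big.
  by rewrite exchange_big.
rewrite E [RHS]E [LHS](reindex_inj oppr_inj); apply: eq_bigr => t _.
rewrite [LHS](reindex_inj (addIr t)); apply: eq_bigr => k _.
by rewrite [LHS](reindex_inj (addIr t)).
Qed.

Let sumD3 (F G : I -> I -> I -> C) :
  \sum_k \sum_l \sum_t F k l t + \sum_k \sum_l \sum_t G k l t =
  \sum_k \sum_l \sum_t (F k l t + G k l t).
Proof.
rewrite -big_split; apply: eq_bigr => k _; rewrite -big_split.
by apply: eq_bigr => l _; rewrite -big_split.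
Qed.

(* Each jump (k, l) -> (k + t, l + t) is averaged with its reversal, which has the same weight. *)
Lemma quad_formE (V : 'M[C]_n) (Z := fun k l => (r k l)%:C * V k l) : - quad_form V =
  (n%:R ^- 2 * (\sum_k \sum_l \sum_t defect k l t * sqrnorm (V k l)
   + \sum_k \sum_l \sum_t W k l t / 2 * sqrnorm (Z k l - Z (k + t) (l + t))))%:C.
Proof.
pose G k l t := (W k l t)%:C * Z k l * (Z k l)^*
  - (W k l t)%:C * Z (k + t) (l + t) * (Z k l)^*.
transitivity ((n%:R ^- 2)%:C * \sum_k \sum_l \sum_t
    ((defect k l t)%:C * (V k l * (V k l)^*) + G k l t)).
  rewrite /quad_form -sumrN mulr_sumr; apply: eq_bigr => k _.
  rewrite -sumrN mulr_sumr; apply: eq_bigr => l _.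
  rewrite mxE -mulrA -mulrN; congr (_ * _).
  rewrite mulr_suml -sumrN; apply: eq_bigr => t _.
  have cZ : (Z k l)^* = (r k l)%:C * (V k l)^* by rewrite /Z rmorphM /= conjCR.
  rewrite /G cZ /Z /defect -/(loss k l t) -/(kappa k l t) kappaW thW.
  move: (W k l t) (r k l) (r (k + t) (l + t)) (loss k l t) ((V k l)^*) (V k l)
    (V (k + t) (l + t)) => w r1 r2 s x y z.
  by rewrite rmorphB !rmorphM /=; ring.
rewrite rmorphM; congr (_ * _).
rewrite -sumD3 rmorphD; congr (_ + _).
  rewrite rmorph_sum; apply: eq_bigr => k _.
  rewrite rmorph_sum; apply: eq_bigr => l _.
  rewrite rmorph_sum; apply: eq_bigr => t _.
  by rewrite mul_conj_sqrnorm rmorphM.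
have h2 : 2 != 0 :> C by rewrite pnatr_eq0.
apply: (mulfI h2); rewrite mulr_natl mulr2n {1}sum_shift sumD3.
rewrite rmorph_sum mulr_sumr; apply: eq_bigr => k _.
rewrite rmorph_sum mulr_sumr; apply: eq_bigr => l _.
rewrite rmorph_sum mulr_sumr; apply: eq_bigr => t _.
rewrite /G WN !addrK; move: (W k l t) (Z k l) (Z (k + t) (l + t)) => w z z'.
rewrite rmorphM /= -mul_conj_sqrnorm rmorphB /=.
have -> : (w / 2)%:C = w%:C / 2 by rewrite rmorphM fmorphV rmorph_nat.
by field.
Qed.

(** * Lower and upper bounds on the Dirichlet form *)

Section bounds.
Hypothesis th_ge0 : forall a b, 0 <= th a b.
Hypothesis beta_gt0 : 0 < beta.
Hypothesis e_le2 : forall k, `|e k| <= 2.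

Let a_le4 k t : `|a k t| <= 4.
Proof.
rewrite /a; have := e_le2 (k + t); have := e_le2 k; rewrite !ler_norml.
by move=> /andP[? ?] /andP[? ?]; apply/andP; split; lra.
Qed.

Let n0 : 0 < n%:R :> R. Proof. by rewrite ltr0n. Qed.

Let W_ge0 k l t : 0 <= W k l t.
Proof. by rewrite mulr_ge0 ?expR_ge0. Qed.

Definition normsq (V : 'M[C]_n) : R := \sum_k \sum_l sqrnorm (V k l).

(** A multiple of rho^(1/2), the image of the Gibbs state under the symmetrization. *)
Definition ground_state : 'M[C]_n :=
  \matrix_(k, l) ((expR (- (beta * e k / 2)))%:C *+ (k == l)).

(** Bounding the flow below by a product of Gibbs weights makes the variance identity applicable.
    The factor exp (- 2 beta) compensates exp (- beta e_j), as e_j >= - 2. *)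
Let W_diag_jump k j w0 : (forall x, `|x| <= 4 -> w0 <= th x x) -> 0 < w0 ->
  expR (- (2 * beta)) * w0 * (expR (- (beta * e k)) * expR (- (beta * e j)))
  <= W k k (j - k).
Proof.
move=> hw w00; rewrite /W.
have := hw _ (a_le4 k (j - k)); set T := th _ _ => hT.
have -> : beta * (e k + e k) / 2 = beta * e k by field.
rewrite mulrC -mulrA; apply: ler_pM; rewrite ?expR_ge0//.
  by rewrite !mulr_ge0 ?expR_ge0// ltW.
rewrite mulrA -expRD; apply: (le_trans _ hT); rewrite ler_piMl ?(ltW w00)//.
rewrite -[leRHS]expR0 ler_expR; have := e_le2 j; rewrite ler_norml => /andP[ej1 _].
suff : 0 <= beta * (e j + 2) by move=> ?; lra.
by apply: mulr_ge0; [exact: ltW|lra].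
Qed.

(** Decoherence controls the off-diagonal entries with constant c d / n. The jump part controls the
    diagonal ones with a constant of order n, once the stationary direction is excluded. The
    prefactor n^-2 turns the weaker of the two into n^-3. *)
Lemma quad_form_ge (c w0 d : R) (V : 'M[C]_n) : 0 < c -> 0 < w0 -> 0 < d ->
  (forall a b, `|a| <= 4 -> `|b| <= 4 ->
     c * (a - b) ^+ 2 <= (th a a + th b b) / 2 - th a b) ->
  (forall a, `|a| <= 4 -> w0 <= th a a) ->
  (forall k l, k != l -> d / n%:R <= \sum_t (a k t - a l t) ^+ 2) ->
  \sum_k \sum_l V k l * (ground_state k l)^* = 0 ->
  (Num.min (c * d) (expR (- (4 * beta)) * w0) * n%:R ^- 3 * normsq V)%:C <= - quad_form V.
Proof.
move=> c0 w00 d0 hc hw hd orth; rewrite quad_formE lecR.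
pose Z k l := (r k l)%:C * V k l.
set M := Num.min _ _.
have M0 : 0 < M by rewrite lt_min !mulr_gt0 ?expR_gt0.
have M1 : M <= c * d by rewrite ge_min lexx.
have M2 : M <= expR (- (4 * beta)) * w0 by rewrite ge_min lexx orbT.
pose diag := \sum_k sqrnorm (V k k).
pose off := \sum_k \sum_(l | l != k) sqrnorm (V k l).
have nE : normsq V = diag + off.
  rewrite /diag /off -big_split; apply: eq_bigr => k _.
  by rewrite (bigD1 k).
have off0 : 0 <= off by do 2!(apply: sumr_ge0 => ? _); exact: sqrnorm_ge0.
have diag0 : 0 <= diag by apply: sumr_ge0 => ? _; exact: sqrnorm_ge0.
have Q1 : c * d / n%:R * off <= \sum_k \sum_l \sum_t defect k l t * sqrnorm (V k l).
  rewrite mulr_sumr; apply: ler_sum => k _.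
  rewrite [leRHS](bigD1 k)//= mulr_sumr.
  have D0 k' l' t : c * (a k' t - a l' t) ^+ 2 <= defect k' l' t by exact: hc.
  apply: ler_wpDl.
    apply: sumr_ge0 => t _; rewrite mulr_ge0 ?sqrnorm_ge0//.
    by apply: le_trans (D0 _ _ _); rewrite mulr_ge0 ?sqr_ge0 ?ltW.
  apply: ler_sum => l lk; rewrite -mulr_suml ler_wpM2r ?sqrnorm_ge0//.
  apply: (@le_trans _ _ (c * \sum_t (a k t - a l t) ^+ 2)).
    by rewrite -mulrA ler_pM2l// hd// eq_sym.
  by rewrite mulr_sumr; apply: ler_sum.
(* One factor exp (- 2 beta) comes from the flow bound and one from the total weight sum p >= exp (-
   2 beta) n. *)
have Q2 : expR (- (4 * beta)) * w0 * n%:R * diag <=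
    \sum_k \sum_l \sum_t W k l t / 2 * sqrnorm (Z k l - Z (k + t) (l + t)).
  pose p k := expR (- (beta * e k)).
  have pV k : p k * sqrnorm (Z k k) = sqrnorm (V k k).
    rewrite /Z sqrnormZ mulrA /r /p expr2 -!expRD (_ : _ + _ = 0) ?expR0 ?mul1r//.
    by field.
  have pZ k : (p k)%:C * Z k k = V k k * (ground_state k k)^*.
    rewrite /Z mxE eqxx mulr1n conjCR mulrA -rmorphM /= mulrC /p /r -expRD.
    by congr (_ * (expR _)%:C); field.
  (* Orthogonality to the ground state says that the diagonal of [Z] has mean zero for the weights
     [p], so its variance is its full second moment. *)
  have S0 : \sum_k (p k)%:C * Z k k = 0.
    rewrite -[RHS]orth; apply: eq_bigr => k _; rewrite pZ (bigD1 k)//= big1 ?addr0//.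
    by move=> l lk; rewrite mxE eq_sym (negbTE lk) mulr0n rmorph0 mulr0.
  have pn : expR (- (2 * beta)) * n%:R <= \sum_k p k.
    rewrite mulr_natr -[n in _ *+ n]card_ord -sumr_const; apply: ler_sum => k _.
    rewrite ler_expR; have := e_le2 k; rewrite ler_norml => /andP[_ ek].
    suff : 0 <= beta * (2 - e k) by move=> ?; lra.
    by apply: mulr_ge0; [exact: ltW|lra].
  have Sre : \sum_k p k * complex.Re (Z k k) = 0.
    transitivity (complex.Re (\sum_k (p k)%:C * Z k k)); last by rewrite S0.
    rewrite (raddf_sum (@complex.Re R : Rcomplex R -> R)) /=.
    by apply: eq_bigr => k _; case: (Z k k) => x y /=; rewrite mul0r subr0.
  have Sim : \sum_k p k * complex.Im (Z k k) = 0.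
    transitivity (complex.Im (\sum_k (p k)%:C * Z k k)); last by rewrite S0.
    rewrite (raddf_sum (@complex.Im R : Rcomplex R -> R)) /=.
    by apply: eq_bigr => k _; case: (Z k k) => x y /=; rewrite mul0r addr0.
  have S2 : \sum_k \sum_j p k * p j * sqrnorm (Z k k - Z j j) = 2 * (\sum_k p k) * diag.
    transitivity (\sum_k \sum_j p k * p j * (complex.Re (Z k k) - complex.Re (Z j j)) ^+ 2
        + \sum_k \sum_j p k * p j * (complex.Im (Z k k) - complex.Im (Z j j)) ^+ 2).
      rewrite -big_split; apply: eq_bigr => k _; rewrite -big_split; apply: eq_bigr => j _ /=.
      by rewrite -mulrDr /sqrnorm; case: (Z k k) (Z j j) => x y [x' y'].
    rewrite !sum_weighted_sqrB Sre Sim expr0n /= !mulr0 !subr0 -mulrDr -big_split.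
    by congr (_ * _); apply: eq_bigr => k _; rewrite /= -mulrDr -/(sqrnorm _) pV.
  (* Only the jumps among diagonal entries are kept; reindexing by j = k + t then displays all pairs
     of sites. *)
  apply: (@le_trans _ _ (\sum_k \sum_t W k k t / 2 * sqrnorm (Z k k - Z (k + t) (k + t)))); last first.
    apply: ler_sum => k _; rewrite [leRHS](bigD1 k)//= lerDl.
    apply: sumr_ge0 => l _; apply: sumr_ge0 => t _.
    by rewrite mulr_ge0 ?sqrnorm_ge0// divr_ge0.
  apply: (@le_trans _ _ (\sum_k \sum_j expR (- (2 * beta)) * w0 / 2 * (p k * p j * sqrnorm (Z k k - Z j j)))).
    under eq_bigr do rewrite -mulr_sumr.
    rewrite -mulr_sumr S2.
    have -> : - (4 * beta) = - (2 * beta) + - (2 * beta) by ring.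
    rewrite expRD; set E := expR _ in pn *.
    have E0 : 0 <= E * w0 * diag by rewrite mulr_ge0// mulr_ge0 ?expR_ge0// ltW.
    have := ler_wpM2l E0 pn; move: (\sum_k p k) => P.
    have -> : E * E * w0 * n%:R * diag = E * w0 * diag * (E * n%:R) by ring.
    by have -> : E * w0 / 2 * (2 * P * diag) = E * w0 * diag * P by field.
  apply: ler_sum => k _.
  rewrite [leRHS](reindex_inj (addIr (- k))); apply: ler_sum => j _.
  have -> : k + (j - k) = j by rewrite addrC subrK.
  rewrite mulrA ler_wpM2r ?sqrnorm_ge0//.
  by rewrite mulrAC ler_pM2r ?invr_gt0//; exact: W_diag_jump.
rewrite nE.
have n1 : 1 <= n%:R :> R by rewrite ler1n.
have -> : M * n%:R ^- 3 * (diag + off) = n%:R ^- 2 * (M / n%:R * off + M / n%:R * diag).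
  by field; rewrite gt_eqF.
rewrite ler_pM2l ?invr_gt0 ?exprn_gt0//; apply: lerD.
  apply: (le_trans _ Q1); rewrite ler_wpM2r// ler_pM2r ?invr_gt0//.
apply: (le_trans _ Q2); rewrite ler_wpM2r//.
apply: (@le_trans _ _ M).
  by rewrite ler_pdivrMr// ler_peMr// ltW.
by rewrite (le_trans M2)// ler_peMr// mulr_ge0 ?expR_ge0 ?ltW.
Qed.

(** Jumps preserve the line l = k + 1; dividing by the weight [r] makes the rescaled entries equal
    to 1 on it and 0 elsewhere, so the jump part of the form vanishes. *)
Definition trial_state : 'M[C]_n :=
  \matrix_(k, l) (((r k l)^-1)%:C *+ (l == k + 1)).

(** Only the defects at l = k + 1 remain. Each of the n shifts contributes at most c (x / n)^2, and
    the prefactor n^-2 gives n^-3 in total. *)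
Lemma quad_form_trial_le (c x : R) :
  (forall a b, (th a a + th b b) / 2 - th a b <= c * (a - b) ^+ 2) -> 0 <= c ->
  (forall k t, `|a k t - a (k + 1) t| <= x / n%:R) ->
  - quad_form trial_state <= (c * x ^+ 2 * n%:R ^- 3 * normsq trial_state)%:C.
Proof.
move=> hc c0 hx; rewrite quad_formE lecR.
rewrite [X in _ + X]big1 ?addr0; last first.
  move=> k _; rewrite big1// => l _; rewrite big1// => t _.
  have ZE i j : (r i j)%:C * trial_state i j = (j == i + 1)%:R.
    by rewrite mxE mulrnAr -rmorphM /= mulfV// gt_eqF// expR_gt0.
  rewrite !ZE addrAC (inj_eq (addIr t)) subrr /sqrnorm /= expr0n /= addr0 mulr0//.
rewrite /normsq mulr_sumr [leRHS]mulr_sumr; apply: ler_sum => k _.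
rewrite mulr_sumr [leRHS]mulr_sumr; apply: ler_sum => l _.
have [->|lk] := eqVneq l (k + 1); last first.
  have -> : trial_state k l = 0 by rewrite mxE (negbTE lk) mulr0n.
  have -> : sqrnorm (0 : C) = 0 by rewrite /sqrnorm /= expr0n addr0.
  by rewrite -mulr_suml !mulr0.
rewrite -mulr_suml mulrA ler_wpM2r ?sqrnorm_ge0//.
have -> : c * x ^+ 2 * n%:R ^- 3 = n%:R ^- 2 * (n%:R * (c * (x / n%:R) ^+ 2)).
  by field; rewrite gt_eqF.
rewrite ler_pM2l ?invr_gt0 ?exprn_gt0//.
rewrite mulr_natl -[n in _ *+ n]card_ord -sumr_const; apply: ler_sum => t _.
apply: (le_trans (hc _ _)); rewrite ler_wpM2l//.
rewrite -real_normK ?num_real// lerXn2r// ?nnegrE//.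
exact: le_trans (normr_ge0 _) (hx k t).
Qed.

(** Gain and loss cancel for each shift t separately. *)
Lemma sym_generator_ground_state : sym_generator ground_state = 0.
Proof.
apply/matrixP => k l; rewrite !mxE big1 ?mulr0// => t _.
rewrite !mxE (inj_eq (addIr t)).
have [->|_] := eqVneq k l; last by rewrite !mulr0n !mulr0 subr0.
rewrite !mulr1n -!rmorphM -rmorphB /= (_ : _ - _ = 0)//.
rewrite mulrAC -expRD (_ : (_ + _) / 2 = th (a l t) (a l t)); last by field.
rewrite [X in _ - X]mulrC (_ : _ / 4 - _ / 2 = - (beta * e l / 2)); last first.
  by rewrite /a; field.
by rewrite subrr.
Qed.

End bounds.
End dirichlet_form.

(** * The cycle *)

Section mxvec_forms.
Context {C : numClosedFieldType} {n : nat}.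

Lemma sum_mxvec (V : nmodType) (F : 'I_(n * n) -> V) :
  \sum_q F q = \sum_k \sum_l F (mxvec_index k l).
Proof.
rewrite (reindex _ (curry_mxvec_bij n n)) pair_bigA /=.
by apply: eq_bigr => -[].
Qed.

Lemma mxvec_dot (A B : 'M[C]_n) :
  (mxvec A *m (mxvec B)^t*) 0 0 = \sum_k \sum_l A k l * (B k l)^*.
Proof.
rewrite mxE sum_mxvec; apply: eq_bigr => k _; apply: eq_bigr => l _.
by rewrite !mxE !mxvecE.
Qed.

Lemma row_lin_mx (f : 'M[C]_n -> 'M[C]_n) i :
  row i (lin_mx f) = mxvec (f (vec_mx (delta_mx 0 i))).
Proof. by apply/rowP => j; rewrite !mxE. Qed.

Lemma lin_mx_hermitian (f : 'M[C]_n -> 'M[C]_n) :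
  (forall i j k l, f (delta_mx i j) k l = (f (delta_mx k l) i j)^*) ->
  (lin_mx f)^t* = lin_mx f.
Proof.
move=> hf; apply/matrixP => p q; rewrite !mxE /=.
case/mxvec_indexP: p => i j; case/mxvec_indexP: q => k l.
by rewrite !vec_mx_delta !mxvecE.
Qed.

(** The right inverse makes the matrix of [S] invertible, and the intertwining relation is read off
    row by row on the matrix units. *)
Lemma lin_mx_intertwined (f : 'M[C]_n -> 'M[C]_n) (g S : {linear 'M[C]_n -> 'M[C]_n})
    (S' : 'M[C]_n -> 'M[C]_n) : (forall X, S (S' X) = X) ->
  (forall X, S (f X) = g (S X)) -> char_poly (lin_mx f) = char_poly (lin_mx g).
Proof.
move=> SS' Sf; have uS : lin_mx S \in unitmx.
  suff h : lin_mx S' *m lin_mx S = 1%:M by have [] := mulmx1_unit h.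
  apply/row_matrixP => i.
  by rewrite row_mul row_lin_mx mul_vec_lin SS' vec_mxK rowE mulmx1.
symmetry; apply: (char_poly_intertwined _ _ (lin_mx S)) => //.
apply/row_matrixP => i; rewrite !row_mul !row_lin_mx !mul_vec_lin.
by rewrite Sf.
Qed.

End mxvec_forms.

(** * The cycle Lindbladian in the plane-wave basis and its gap *)

Section cycle.
Context {R : realType} {m : nat}.
Local Notation C := R[i].
Local Notation n := m.+3.
Local Notation I := 'I_m.+3.
Local Notation H := (cycle_adjacency R n).

Let s : R := (Num.sqrt (n%:R : R))^-1.

Let s2 : s ^+ 2 = n%:R^-1.
Proof. by rewrite exprVn sqr_sqrtr ?ler0n. Qed.

Definition plane_waves : 'M[C]_n := \matrix_(k, j) (s%:C * chi (k * j)).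
Local Notation U := plane_waves.

Let nC : n%:R != 0 :> C. Proof. by rewrite pnatr_eq0. Qed.

Let sC : s%:C ^+ 2 = n%:R^-1 :> C.
Proof. by rewrite -rmorphXn /= s2 fmorphV rmorph_nat. Qed.

Let conj_chi (k : I) : (chi k)^* = chi (- k) :> C.
Proof. by rewrite chiN. Qed.

Lemma plane_waves_unitary : U \is unitarymx.
Proof.
apply/unitarymxP/matrixP => k l; rewrite !mxE.
transitivity (n%:R^-1 * \sum_(j : I) chi ((k - l) * j) : C).
  rewrite mulr_sumr; apply: eq_bigr => j _; rewrite !mxE rmorphM /= conjCR.
  by rewrite conj_chi mulrACA -expr2 sC -chiD mulrBl.
rewrite sum_chi subr_eq0; case: eqP => _; last by rewrite mulr0.
by rewrite mulVf.
Qed.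

Let ordS_add1 (i : I) : ordS i = i + 1.
Proof. by apply: val_inj; rewrite /= modnDmr addn1. Qed.

Lemma plane_waves_diagonalize :
  U *m H = diag_mx (\row_k (energy k)%:C) *m U.
Proof.
apply/matrixP => k j; rewrite mul_diag_mx !mxE energyE.
(* As n >= 3, the two neighbours of a vertex are distinct, so the disjunction in the adjacency
   matrix splits into a sum. *)
have neq2 (i : I) : (j == i + 1) && (i == j + 1) = false.
  apply/negP => /andP[/eqP -> ]; rewrite eq_sym -addrA addrC -subr_eq0 addrK.
  by rewrite -val_eqE /= !modn_small.
transitivity (\sum_(i : I) ((if i == j - 1 then s%:C * chi (k * i) else 0) +
   (if i == j + 1 then s%:C * chi (k * i) else 0))).
  apply: eq_bigr => i _; rewrite !mxE !ordS_add1.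
  have := neq2 i; rewrite -[j == i + 1]subr_eq [j - 1 == i]eq_sym.
  by case: (i == j - 1); case: (i == j + 1) => //= _; rewrite ?mulr1 ?mulr0 ?addr0 ?add0r.
rewrite big_split -!big_mkcond /= !big_pred1_eq.
rewrite conj_chi mulrBr mulrDr mulr1 !chiD; ring.
Qed.

Local Notation hat := (in_eigenbasis U).

Lemma in_eigenbasis_vertex_jump (v k l : I) :
  hat (vertex_jump R v) k l = s%:C ^+ 3 * chi ((k - l) * v).
Proof.
rewrite /vertex_jump -/s in_eigenbasisZ.
have E : (hat (delta_mx v v)) k l = U k v * (U l v)^*.
  rewrite /in_eigenbasis mxE (bigD1 v)//= big1 ?addr0; last first.
    move=> j jv; rewrite mxE big1 ?mul0r// => i _; rewrite !mxE.
    by rewrite (negbTE jv) andbF mulr0.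
  rewrite mxE (bigD1 v)//= big1 ?addr0; last first.
    by move=> j jv; rewrite [delta_mx _ _ _ _]mxE (negbTE jv) mulr0.
  have -> : (delta_mx v v : 'M[C]_n) v v = 1 by rewrite mxE !eqxx.
  have -> : (U^t*) v l = (U l v)^* by rewrite !mxE.
  by rewrite mulr1.
move: E; move: (hat _) => D E; rewrite mxE E !mxE rmorphM /= conjCR conj_chi.
rewrite mulrBl chiD; ring.
Qed.

(** Averaging over the vertices forces equal momentum transfer. The value is s^6 n = n^-2, where
    each jump entry brings s^3: one factor from its normalization and two from the plane waves. *)
Lemma vertex_jump_second_moment (i j i' j' : I) :
  \sum_v hat (vertex_jump R v) i j * (hat (vertex_jump R v) i' j')^* =
  if i - j == i' - j' then (n%:R ^- 2)%:C else 0.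
Proof.
transitivity (s%:C ^+ 6 * \sum_v chi ((i - j - (i' - j')) * v)).
  rewrite mulr_sumr; apply: eq_bigr => v _; rewrite !in_eigenbasis_vertex_jump.
  rewrite rmorphM /= rmorphXn /= conjCR conj_chi mulrACA -exprD -chiD.
  by rewrite -mulNr -mulrDl.
rewrite sum_chi subr_eq0; case: eqP => _; last by rewrite mulr0.
rewrite (exprM _ 2 3) sC fmorphV rmorphXn /= rmorph_nat.
by field.
Qed.

Variables (beta sigma : R).
Hypothesis sigma_gt0 : 0 < sigma.
Hypothesis beta_gt0 : 0 < beta.
Local Notation th := (theta beta sigma).
Local Notation e := (@energy R m).
Local Notation L := (@cycle_lindbladian R n beta sigma).
Local Notation sym := (sym_generator beta th e).

Let a (k t : I) : R := e (k + t) - e k.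
Let r (k l : I) : R := expR (beta * (e k + e l) / 4).

Let cross (k k' l : I) : k != k' ->
  \sum_v (hat (vertex_jump R v) l k)^* * hat (vertex_jump R v) l k' = 0.
Proof.
move=> kk'; under eq_bigr do rewrite mulrC.
rewrite vertex_jump_second_moment; case: eqP => // h.
by move: kk'; rewrite (oppr_inj (addrI l h)) eqxx.
Qed.

(** Writing the source row as k + t, momentum conservation leaves only the source column l + t. *)
Lemma in_eigenbasis_cycle_lindbladian X k l : hat (L X) k l =
  (n%:R ^- 2)%:C * \sum_t ((th (- a k t) (- a l t))%:C * hat X (k + t) (l + t)
   - ((th (a k t) (a k t) + th (a l t) (a l t)) / 2)%:C * hat X k l).
Proof.
rewrite /cycle_lindbladian (in_eigenbasis_lindbladian _ _ _ plane_waves_unitary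
  plane_waves_diagonalize _ _ _ _ sigma_gt0 beta_gt0 cross).
move: (hat X) => Y; rewrite sumrB mulrBr; congr (_ - _).
  under eq_bigr => j _.
    under eq_bigr => j' _ do rewrite vertex_jump_second_moment.
    over.
  rewrite [LHS](reindex_inj (addrI k)) mulr_sumr; apply: eq_bigr => t _.
  have kt (x : I) : x - (x + t) = - t by rewrite opprD addrA subrr add0r.
  rewrite (bigD1 (l + t))//= big1 ?addr0; last first.
    move=> j /negbTE jl; case: eqP => h; last by rewrite mulr0 mul0r.
    move: jl; have <- : l - (l - j) = j by rewrite subKr.
    by rewrite -h kt opprK eqxx.
  by rewrite !kt eqxx /a !opprB mulrAC mulrC.
rewrite -mulr_suml mulrA; congr (_ * _).
have E (k' : I) : \sum_i (th (e i - e k') (e i - e k'))%:C *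
    (\sum_v hat (vertex_jump R v) i k' * (hat (vertex_jump R v) i k')^*) =
  (n%:R ^- 2)%:C * \sum_t (th (a k' t) (a k' t))%:C.
  rewrite (reindex_inj (addrI k')) mulr_sumr; apply: eq_bigr => t _.
  by rewrite vertex_jump_second_moment eqxx mulrC.
rewrite !E -mulrDr mulrCA; congr (_ * _); rewrite -big_split mulr_sumr.
apply: eq_bigr => t _ /=; rewrite rmorphM rmorphD /= fmorphV rmorph_nat.
by rewrite mulrC.
Qed.

Definition kms_transform (X : 'M[C]_n) : 'M[C]_n :=
  \matrix_(k, l) ((r k l)%:C * hat X k l).

Let kmsE X k l : kms_transform X k l = (r k l)%:C * hat X k l.
Proof. by rewrite /kms_transform; move: (hat X) => Y; rewrite mxE. Qed.

Lemma kms_transform_is_linear : linear kms_transform.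
Proof.
move=> c X Y; apply/matrixP => k l.
have E : hat (c *: X + Y) = c *: hat X + hat Y.
  by rewrite /in_eigenbasis mulmxDr mulmxDl -scalemxAr -scalemxAl.
have D (P Q : 'M[C]_n) : (c *: P + Q) k l = c * P k l + Q k l by rewrite !mxE.
by rewrite kmsE E !D !kmsE; ring.
Qed.

Lemma kms_transform_lindbladian X :
  kms_transform (L X) = sym (kms_transform X).
Proof.
apply/matrixP => k l; rewrite kmsE in_eigenbasis_cycle_lindbladian.
have symE V : sym V k l = (n%:R ^- 2)%:C * \sum_t
    ((expR (beta * (a k t + a l t) / 4) * th (a k t) (a l t))%:C * V (k + t) (l + t)
     - ((th (a k t) (a k t) + th (a l t) (a l t)) / 2)%:C * V k l) by rewrite mxE.
rewrite symE mulrCA; congr (_ * _); rewrite mulr_sumr; apply: eq_bigr => t _.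
rewrite !kmsE; move: (hat X _ _) (hat X _ _) => x y.
(* Detailed balance for one jump, absorbed by the ratio of the weights [r] at its two ends. *)
have E : expR (beta * (a k t + a l t) / 4) * th (a k t) (a l t) * r (k + t) (l + t) =
    r k l * th (- a k t) (- a l t).
  rewrite [th (- _) _]theta_detailed_balance// !opprK mulrAC mulrA -!expRD.
  by congr (expR _ * _); rewrite /a; field.
move: (expR _ * th _ _) (r (k + t) _) (r k l) (th (- _) _) (_ / 2) E.
move=> A r' r0 B D E; rewrite mulrBr !mulrA -!rmorphM /= E; congr (_ - _ * _).
by rewrite mulrC.
Qed.

Let kms_transform_inv (Y : 'M[C]_n) : 'M[C]_n :=
  U^t* *m (\matrix_(k, l) (((r k l)^-1)%:C * Y k l)) *m U.

Let kms_transformK Y : kms_transform (kms_transform_inv Y) = Y.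
Proof.
have UU : U *m U^t* = 1%:M by apply/unitarymxP; exact: plane_waves_unitary.
apply/matrixP => k l; rewrite kmsE /kms_transform_inv /in_eigenbasis !mulmxA UU mul1mx.
rewrite -mulmxA UU mulmx1 mxE mulrA -rmorphM /= mulfV ?mul1r//.
by rewrite gt_eqF// expR_gt0.
Qed.

Lemma kms_transform_inj X : kms_transform X = 0 -> X = 0.
Proof.
move=> SX0; apply: (in_eigenbasis_inj _ plane_waves_unitary).
apply/matrixP => k l; have /matrixP/(_ k l) := SX0; rewrite kmsE [RHS]mxE.
move/eqP; rewrite mulf_eq0 => /orP[|/eqP ->].
  by rewrite (inj_eq (@complexI R) _ 0) gt_eqF// expR_gt0.
by rewrite /in_eigenbasis mulmx0 mul0mx mxE.
Qed.

Lemma char_poly_cycle_lindbladian :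
  char_poly (lin_mx L) = char_poly (lin_mx sym).
Proof.
pose symL : {linear 'M[C]_n -> 'M[C]_n} := HB.pack sym
  (GRing.isLinear.Build C 'M[C]_n 'M[C]_n *:%R sym (sym_generator_is_linear beta th e)).
pose kmsL : {linear 'M[C]_n -> 'M[C]_n} := HB.pack kms_transform
  (GRing.isLinear.Build C 'M[C]_n 'M[C]_n *:%R kms_transform kms_transform_is_linear).
exact: (@lin_mx_intertwined _ _ L symL kmsL kms_transform_inv kms_transformK
  kms_transform_lindbladian).
Qed.

Local Notation rho := (gibbs_state H beta).

Let boltzmann_trace_gt0 : 0 < \tr (boltzmann H beta).
Proof.
have UtU : U^t* *m U = 1%:M.
  by rewrite -(invmx_unitary plane_waves_unitary) mulVmx// unitarymx_unit// plane_waves_unitary.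
have -> : \tr (boltzmann H beta) = \tr (hat (boltzmann H beta)).
  by rewrite /in_eigenbasis mxtrace_mulC mulmxA UtU mul1mx.
rewrite (in_eigenbasis_boltzmann _ _ _ plane_waves_unitary plane_waves_diagonalize).
rewrite mxtrace_diag.
have h k : 0 < (\row_k0 (expR (- beta * e k0))%:C : 'rV[C]_n) 0 k.
  by rewrite mxE ltcR expR_gt0.
rewrite (bigD1 ord0)//= ltr_wpDr//.
by apply: sumr_ge0 => k _; exact: ltW.
Qed.

Lemma kms_transform_gibbs :
  kms_transform rho = (\tr (boltzmann H beta))^-1 *: ground_state beta e.
Proof.
apply/matrixP => k l; rewrite kmsE /gibbs_state in_eigenbasisZ.
rewrite (in_eigenbasis_boltzmann _ _ _ plane_waves_unitary plane_waves_diagonalize).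
rewrite !mxE mulrCA; congr (_ * _).
have [->|_] := eqVneq k l; last by rewrite !mulr0n mulr0.
by rewrite !mulr1n -rmorphM /= /r -expRD; congr (expR _)%:C; field.
Qed.

Lemma gibbs_state_neq0 : rho != 0.
Proof.
apply/negP => /eqP h; have := kms_transform_gibbs; rewrite h.
have -> : kms_transform 0 = 0.
  by apply/matrixP => k l; rewrite kmsE /in_eigenbasis mulmx0 mul0mx !mxE mulr0.
move/matrixP/(_ 0 0)/eqP; rewrite !mxE eqxx mulr1n eq_sym mulf_eq0 invr_eq0.
by rewrite gt_eqF//= (inj_eq (@complexI R) _ 0) gt_eqF// expR_gt0.
Qed.

Lemma cycle_lindbladian_gibbs : L rho = 0.
Proof.
apply: kms_transform_inj; rewrite kms_transform_lindbladian kms_transform_gibbs.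
have -> : sym ((\tr (boltzmann H beta))^-1 *: ground_state beta e) =
    (\tr (boltzmann H beta))^-1 *: sym (ground_state beta e).
  have := sym_generator_is_linear beta th e (\tr (boltzmann H beta))^-1 (ground_state beta e) 0.
  rewrite !addr0 => ->.
  have -> : sym 0 = 0; last by rewrite addr0.
  apply/matrixP => k l; rewrite !mxE big1 ?mulr0// => t _.
  by rewrite !mxE !mulr0 subr0.
by rewrite sym_generator_ground_state ?scaler0.
Qed.

Let th_balance := theta_detailed_balance beta sigma sigma_gt0 beta_gt0.

Let mxvec_quad_formE V : (mxvec V *m lin_mx sym *m (mxvec V)^t*) 0 0 = quad_form beta th e V.
Proof.
pose symL : {linear 'M[C]_n -> 'M[C]_n} := HB.pack sym
  (GRing.isLinear.Build C 'M[C]_n 'M[C]_n *:%R sym (sym_generator_is_linear beta th e)).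
by rewrite (mul_vec_lin symL) mxvec_dot.
Qed.

Let normE (V : 'M[C]_n) : (mxvec V *m (mxvec V)^t*) 0 0 = (normsq V)%:C.
Proof.
rewrite mxvec_dot rmorph_sum; apply: eq_bigr => k _; rewrite rmorph_sum.
by apply: eq_bigr => l _; rewrite mul_conj_sqrnorm.
Qed.

(** The gap criterion is applied to the symmetrized generator, which has the same characteristic
    polynomial. The 2 comes from the dispersion bound 2 / n, the 8 pi from neighbouring momenta, and
    (8 sigma^2)^-1 from the upper bound on the defect. *)
Lemma cycle_spectral_gap (c w0 : R) : 0 < c -> 0 < w0 ->
  (forall x y, `|x| <= 4 -> `|y| <= 4 ->
     c * (x - y) ^+ 2 <= (th x x + th y y) / 2 - th x y) ->
  (forall x, `|x| <= 4 -> w0 <= th x x) ->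
  exists2 g, is_spectral_gap L rho g &
    Num.min (c * 2) (expR (- (4 * beta)) * w0) * n%:R ^- 3 <= g <=
    (8 * sigma ^+ 2)^-1 * (8 * pi) ^+ 2 * n%:R ^- 3.
Proof.
move=> c0 w00 hc hw.
set lo := Num.min _ _ * n%:R ^- 3; set up := (8 * _)^-1 * _ * n%:R ^- 3.
have s20 : 0 < 8 * sigma ^+ 2 by rewrite mulr_gt0// exprn_gt0.
have lo0 : 0 < lo.
  apply: mulr_gt0; last by rewrite invr_gt0 exprn_gt0 ?ltr0n.
  by rewrite lt_min !mulr_gt0 ?expR_gt0.
have hd k l : k != l -> 2 / n%:R <= \sum_t (a k t - a l t) ^+ 2.
  exact: energy_dispersion_ge.
have [g [sp [glu cp ex mn]]] : exists (g : R) (s : seq C),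
    [/\ lo <= g <= up, char_poly (lin_mx sym) = \prod_(l <- 0 :: s) ('X - l%:P),
        exists2 l, l \in s & `|l| = g%:C
      & forall l, l \in s -> g%:C <= `|l| ].
  apply: (hermitian_spectral_gap _ _ (mxvec (ground_state beta e))
    (mxvec (trial_state beta e))) => //.
  - apply: lin_mx_hermitian => i j k l.
    exact: (sym_generator_hermitian _ _ _ th_balance).
  - rewrite mxvec_eq0; apply/negP => /eqP/matrixP/(_ 0 0)/eqP.
    by rewrite !mxE eqxx mulr1n (inj_eq (@complexI R) _ 0) gt_eqF// expR_gt0.
  - pose symL : {linear 'M[C]_n -> 'M[C]_n} := HB.pack sym
      (GRing.isLinear.Build C 'M[C]_n 'M[C]_n *:%R sym (sym_generator_is_linear beta th e)).
    by rewrite (mul_vec_lin symL) /= sym_generator_ground_state// linear0.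
  - move=> u; rewrite -[u]vec_mxK mxvec_dot => orth; rewrite mxvec_quad_formE normE -rmorphM.
    apply: (@quad_form_ge R m beta th e) => //.
      exact: theta_ge0.
    exact: energy_le2.
  - rewrite mxvec_eq0; apply/negP => /eqP/matrixP/(_ 0 1)/eqP.
    rewrite !mxE add0r eqxx mulr1n (inj_eq (@complexI R) _ 0) invr_eq0.
    by rewrite gt_eqF// expR_gt0.
  - rewrite mxvec_dot big1// => k _; rewrite big1// => l _; rewrite !mxE.
    case: (eqVneq k l) => [<-|_]; last by rewrite mulr0n rmorph0 mulr0.
    have -> : (k == k + 1) = false.
      by rewrite -[X in X == _]addr0 (inj_eq (addrI k)) eq_sym oner_eq0.
    by rewrite mulr0n mul0r.
  - rewrite mxvec_quad_formE normE -rmorphM; apply: (quad_form_trial_le _ _ _ th_balance).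
    + move=> x y; rewrite [leRHS]mulrC; exact: theta_defect_le.
    + by rewrite invr_ge0 ltW.
    + by move=> k t; exact: energyB_succ_le.
exists g => //; exists sp; split => //.
- exact: gibbs_state_neq0.
- exact: cycle_lindbladian_gibbs.
- by rewrite char_poly_cycle_lindbladian.
Qed.

End cycle.

Theorem theorem2p1 (R : realType) (beta : R) (beta_gt0 : 0 < beta) :
  exists sigmaE : R, 0 < sigmaE /\
    exists gap : nat -> R,
      (forall n : nat, (3 <= n)%N ->
         is_spectral_gap (@cycle_lindbladian R n beta sigmaE)
           (gibbs_state (cycle_adjacency R n) beta) (gap n)) /\
      gap \is 'Theta_\oo (fun n : nat => (n%:R : R) ^- 3).
Proof.
(* The estimates hold for every positive resolution; 1 is one choice. *)
exists 1; split => //.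
have [c c0 hc] := theta_defect_ge beta 1 ltr01 beta_gt0.
have [w0 w00 hw] := theta_diag_lb beta 1 ltr01 beta_gt0.
have /choice[gap hgap] (n : nat) : exists g, (3 <= n)%N ->
    is_spectral_gap (@cycle_lindbladian R n beta 1)
      (gibbs_state (cycle_adjacency R n) beta) g /\
    Num.min (c * 2) (expR (- (4 * beta)) * w0) * n%:R ^- 3 <= g <=
    (8 * 1 ^+ 2)^-1 * (8 * pi) ^+ 2 * n%:R ^- 3.
  (* For n < 3 the gap function takes the dummy value 0. *)
  case: n => [|[|[|m]]]; try by exists 0.
  have [g hg hb] := @cycle_spectral_gap R m beta 1 ltr01 beta_gt0 c w0 c0 w00 hc hw.
  by exists g.
exists gap; split; first by move=> n n3; have [] := hgap n n3.
rewrite qualifE; apply/asboolP.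
exists (Num.min (c * 2) (expR (- (4 * beta)) * w0),
  (8 * 1 ^+ 2)^-1 * (8 * pi) ^+ 2) => /=.
  apply/andP; split; first by rewrite lt_min !mulr_gt0 ?expR_gt0.
  rewrite expr1n mulr1 mulr_gt0 ?invr_gt0// exprn_gt0// mulr_gt0//.
  exact: pi_gt0.
near=> n.
have n3 : (3 <= n)%N by near: n; exact: nbhs_infty_ge.
have [_ /andP[h1 h2]] := hgap n n3.
have n0 : 0 <= (n%:R : R) ^- 3 by rewrite invr_ge0 exprn_ge0.
(* Nonnegativity removes the absolute values in the definition of Theta. *)
have g0 : 0 <= gap n.
  apply: (le_trans _ h1); rewrite mulr_ge0// le_min.
  by rewrite !mulr_ge0 ?expR_ge0 ?ltW.
by rewrite !ger0_norm.
Unshelve. all: by end_near. Qed.
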